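(* Let $t\in\mathbb{R}$, $\eta\in\mathbb{R}$, $\lambda>-1/2$, $b=\lambda+i\eta$, and let $\Phi_n$ be the monic orthogonal polynomials on the unit circle with respect to the weight function $$w(\theta)=e^{t\cos(\theta)}e^{-\eta\theta}[\sin^2(\theta/2)]^{\lambda},\qquad 0\le\theta\le2\pi.$$ Put $$\mathfrak{s}_{n,n}=-(\overline b+n)+(t/2)(1+\alpha_n\overline{\alpha}_{n-1}),$$ $$f_n=(1-\mathfrak{s}_{n,n})\alpha_n+(t/2)(1-|\alpha_n|^2)\alpha_{n+1},$$ $$\gamma_n=(t/2)(\mathfrak{s}_{n,n}+\overline{\mathfrak{s}}_{n,n}\overline{\alpha}_n\alpha_{n-1}+\overline{\alpha}_nf_n+\alpha_{n-1}\overline{f}_n).$$ Then, for $n\ge1$, $\Phi_n$ and the reversed polynomial $\Phi_n^*$ satisfy $$\begin{aligned} z^2(z-1)\Phi_n''(z)&+[(t/2)z^3+(b+3-n-t/2)z^2+(\overline b+n-2-t/2)z+t/2]\Phi_n'(z)\\ &-\{(t/2)nz^2+[n(b+2)+\gamma_n-t\overline{\alpha}_n\alpha_{n-1}]z-(t/2)n+\mathfrak{s}_{n,n}-\overline{\gamma}_n\}\Phi_n(z)\\ &=-[t\overline{\alpha}_nz+\overline{f}_n]\Phi_n^*(z), \end{aligned}$$ and $$\begin{aligned} z^2(1-z)(\Phi_n^* )''(z)&-\{(t/2)z^3+(b+2-n-t/2)z^2+(\overline b+n-1-t/2)z+t/2\}(\Phi_n^* )'(z)\\ &+\{(t/2)(n-2)z^2+[n(b+1)+\gamma_n+\overline{\mathfrak{s}}_{n,n}]z-\overline{\gamma}_n-(t/2)n\}\Phi_n^*(z)\\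 &=z(t\alpha_{n-1}z+f_n)\Phi_n(z). \end{aligned}$$
   Context: The monic orthogonal polynomials $\Phi_n$ ($\deg\Phi_n=n$) are orthogonal for $\langle f,g\rangle=\int_0^{2\pi}f(e^{i\theta})\overline{g(e^{i\theta})}\,w(\theta)\,d\theta$. Reversed polynomial: $\Phi_n^*(z)=z^n\overline{\Phi_n(1/\overline z)}$. Verblunsky coefficients: $\alpha_{n-1}=-\overline{\Phi_n(0)}$ for $n\ge1$, and $\alpha_{-1}=-1$. Prime denotes $d/dz$. *)

(* Defs.v *)
From HB Require Import structures.
From mathcomp Require Import all_boot all_order all_algebra.
From mathcomp Require Import complex.
From mathcomp Require Import all_classical all_reals all_analysis.

Set Implicit Arguments.
Unset Strict Implicit.
Unset Printing Implicit Defensive.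

Import Order.TTheory GRing.Theory Num.Theory.

Local Open Scope classical_set_scope.
Local Open Scope ring_scope.

(* Throughout, z^* is the conjugation [Num.conj] of ring_scope on R[i], which
   [conj_complexE] identifies with the componentwise [conjc]. *)
Lemma conj_complexE (R : realType) (z : R[i]) :
  z^* = (complex.Re z -i* complex.Im z)%C.
Proof. by case: z. Qed.

Section UnitCircle.
Variable R : realType.

Definition expi (theta : R) : R[i] := (cos theta +i* sin theta)%C.

(* The Lebesgue integral over [0, 2pi] of a complex-valued function. *)
Definition circle_integral (F : R -> R[i]) : R[i] :=
  ((\int[lebesgue_measure]_(theta in `[0, 2 * pi]) complex.Re (F theta)) +i*
   (\int[lebesgue_measure]_(theta in `[0, 2 * pi]) complex.Im (F theta)))%C.

Definition circle_inner (w : R -> R) (f g : {poly R[i]}) : R[i] :=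
  circle_integral (fun theta =>
    f.[expi theta] * (g.[expi theta])^* * (w theta)%:C%C).

Definition monic_orthogonal (w : R -> R) (Phi : nat -> {poly R[i]}) : Prop :=
  [/\ forall n, Phi n \is monic,
      forall n, size (Phi n) = n.+1
    & forall m n, m != n -> circle_inner w (Phi m) (Phi n) = 0].

(* When lam < 0 the weight is singular at theta = 0 and theta = 2pi, where powR
   takes the value 0; this affects only a null set. *)
Definition weight (t eta lam theta : R) : R :=
  expR (t * cos theta) * expR (- (eta * theta)) *
  (sin (theta / 2) ^+ 2) `^ lam.

(* The reversal z^n * conj (p (1 / conj z)), written on coefficients so that it
   is a polynomial, defined at z = 0 as well; see [horner_reversed]. *)
Definition reversed (n : nat) (p : {poly R[i]}) : {poly R[i]} :=
  \poly_(i < n.+1) (p`_(n - i))^*.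

Lemma horner_reversed (n : nat) (p : {poly R[i]}) (z : R[i]) :
  (size p <= n.+1)%N -> z != 0 ->
  (reversed n p).[z] = z ^+ n * (p.[(z^*)^-1])^*.
Proof.
move=> sz z0; rewrite horner_poly (horner_coef_wide _ sz) raddf_sum mulr_sumr.
rewrite (reindex_inj rev_ord_inj) /=; apply: eq_bigr => i _.
have lein : (i <= n)%N by rewrite -ltnS.
rewrite subSS subKn// rmorphM rmorphXn fmorphV /= conjCK mulrCA.
by rewrite exprVn expfB_cond ?(negPf z0).
Qed.

(* alpha_k for k >= -1; integers below -1 are never used. *)
Definition verblunsky (Phi : nat -> {poly R[i]}) (k : int) : R[i] :=
  if k is Posz m then - ((Phi m.+1).[0])^* else -1.

Section Coefficients.
Variables (t : R) (b : R[i]) (alpha : int -> R[i]) (n : nat).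

Definition s_coef : R[i] :=
  - (b^* + n%:R) + t%:C%C / 2 * (1 + alpha n%:Z * (alpha (n%:Z - 1))^*).

Definition f_coef : R[i] :=
  (1 - s_coef) * alpha n%:Z
  + t%:C%C / 2 * (1 - `|alpha n%:Z| ^+ 2) * alpha (n%:Z + 1).

Definition gamma_coef : R[i] :=
  t%:C%C / 2 * (s_coef + s_coef^* * (alpha n%:Z)^* * alpha (n%:Z - 1)
    + (alpha n%:Z)^* * f_coef + alpha (n%:Z - 1) * f_coef^*).

End Coefficients.
End UnitCircle.

(* Main.v *)
Require Import Defs.
From HB Require Import structures.
From mathcomp Require Import all_boot all_order all_algebra.
From mathcomp Require Import complex.
From mathcomp Require Import all_classical all_reals all_analysis.
From mathcomp Require Import measurable_realfun ring lra zify.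

Set Implicit Arguments.
Unset Strict Implicit.
Unset Printing Implicit Defensive.

Import Order.TTheory GRing.Theory Num.Theory.
Import numFieldNormedType.Exports.

Local Open Scope ring_scope.

(* Integrating the derivative of (z - 1) f(z) conj(g(z)) w over the circle (the
   boundary terms vanish because lam > -1/2) gives a Pearson identity for the
   inner product, which expresses <z (z - 1) f', g> through f, g and z g' alone.
   Applied to f = Phi_n against Phi_n and against Phi_n^*, and combined with the
   Szego recurrence, it gives the value of gamma_n in terms of the subleading
   coefficient of Phi_n and a discrete Painleve equation for alpha_n.  Applied to
   f and to f' against z^j, it shows that the difference of the two sides of each
   equation is orthogonal to z, ..., z^n; this difference also has degree at most
   n and no constant term, hence it is orthogonal to itself and vanishes. *)

(** * Integration of derivatives that are unbounded at the endpoints *)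

Section FTC.
Local Open Scope classical_set_scope.
Local Open Scope ring_scope.
Variable R : realType.
Local Notation mu := (@lebesgue_measure R).

(** For lam < 0 the weight is unbounded at both ends of [0, 2 pi], and exp(- eta theta) makes it
    non-periodic, so integration by parts can rely neither on continuity up to the ends nor on
    periodicity. The factor z - 1 = 2 i e^(i theta/2) sin(theta/2) repairs this: it turns
    |sin(theta/2)|^(2 lam) into a power with the positive exponent 2 lam + 1, which is continuous
    and vanishes at both ends. The analysis serves only to establish that the form is Hermitian and
    definite, that multiplication by z is an isometry, and that the Pearson identity holds; the rest
    is algebra for an abstract form with these properties. The discrete Painleve equation is
    indispensable because f_n is defined through alpha_{n+1}, whereas the coefficient of z in Phi_n
    and that of z^(n-1) in Phi_n^* involve alpha_{n-2}: the equation expresses f_n through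
    either. *)

Lemma FTC_interior (g G : R -> R) (a b x y : R) :
  {in `]a, b[, continuous g} ->
  (forall z, z \in `]a, b[ -> is_derive z 1 G (g z)) ->
  a < x -> x < y -> y < b ->
  (\int[mu]_(z in `[x, y]) (g z)%:E = (G y - G x)%:E)%E.
Proof.
move=> cg dG ax xy yb.
have sub z : z \in `[x, y] -> z \in `]a, b[.
  by rewrite !in_itv/= => /andP[xz zy]; rewrite (lt_le_trans ax) ?(le_lt_trans zy).
have sub' z : z \in `]x, y[ -> z \in `]a, b[.
  by move=> zxy; apply: sub; exact: subset_itv_oo_cc zxy.
have cG z : z \in `[x, y] -> {for z, continuous G}.
  move=> /sub zab; apply: differentiable_continuous; apply/derivable1_diffP.
  by have dGz := dG _ zab; exact: ex_derive.
rewrite EFinB; apply: continuous_FTC2 => //.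
- apply: continuous_in_subspaceT => z /[!inE] /= zxy.
  by apply: cg; exact: sub.
- split.
  + by move=> z /sub' /dG dGz; exact: ex_derive.
  + by apply: cvg_at_right_filter; apply: cG; rewrite in_itv/= lexx ltW.
  + by apply: cvg_at_left_filter; apply: cG; rewrite in_itv/= lexx ltW.
- by move=> z /sub' /dG dGz; rewrite derive1E derive_val.
Qed.

(** Inside the interval the indefinite integral [I] and [G] differ by a constant. Integrability of
    [g] makes [I] continuous up to the endpoints, and [G] is so by hypothesis, hence the constant
    can be read off at both ends although [g] may blow up there. *)
Lemma FTC_integrable (g G : R -> R) (a b : R) : a < b ->
  mu.-integrable `[a, b] (EFin \o g) ->
  {in `]a, b[, continuous g} -> continuous G ->
  (forall z, z \in `]a, b[ -> is_derive z 1 G (g z)) ->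
  \int[mu]_(z in `[a, b]) g z = G b - G a.
Proof.
move=> ab ig cg cG dG.
pose I x := \int[mu]_(z in `[a, x]) g z.
pose c := (a + b) / 2.
have [ac cb] : a < c /\ c < b by rewrite /c; split; lra.
have DI x : a < x -> x < b -> I x - G x = I c - G c.
  have step u v : a < u -> u < v -> v < b -> I v - G v = I u - G u.
    move=> au uv vb.
    have iv : mu.-integrable `[a, v] (EFin \o g).
      by apply: integrableS ig => //; apply: subset_itvl; rewrite bnd_simp ltW.
    have := @Rintegral_itvB R g (BLeft a) (BRight v) u iv.
    rewrite !bnd_simp => /(_ (ltW au) (ltW uv)).
    rewrite Rintegral_itv_obnd_cbnd; last first.
      by apply: integrableS iv => //; apply: subset_itvr; rewrite bnd_simp ltW.
    rewrite -/(I u) -/(I v) /Rintegral (FTC_interior cg dG au uv vb)/= => e.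
    lra.
  move=> ax xb; have [xc|cx|->//] := ltgtP x c; last exact: step.
  by rewrite (step x c).
have La : I x - G x @[x --> a^'+] --> - G a.
  rewrite -[X in _ --> X]add0r; apply: cvgB.
    apply: cvg_at_right_filter.
    exact: (parameterized_integral_cvg_left ab ig).
  by apply: cvg_at_right_filter; exact: cG.
have Lb : I x - G x @[x --> b^'-] --> I b - G b.
  apply: cvgB; first exact: (parameterized_integral_cvg_at_left ab ig).
  by apply: cvg_at_left_filter; exact: cG.
have La' : I x - G x @[x --> a^'+] --> I c - G c.
  apply: cvg_near_cst; near=> x; apply: DI; near: x.
    exact: nbhs_right_gt.
  exact: nbhs_right_lt.
have Lb' : I x - G x @[x --> b^'-] --> I c - G c.
  apply: cvg_near_cst; near=> x; apply: DI; near: x.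
    exact: nbhs_left_gt.
  exact: nbhs_left_lt.
have e1 : - G a = I c - G c := cvg_unique (@Rhausdorff R) La La'.
have e2 : I b - G b = I c - G c := cvg_unique (@Rhausdorff R) Lb Lb'.
by rewrite -/(I b) -(subrK (G b) (I b)) e2 -e1 addrC.
Unshelve. all: by end_near. Qed.

(** Monotone convergence along compact intervals exhausting the open one: each integral is an
    increment of [G], and these converge to the finite number [G b - G a]. *)
Lemma ge0_FTC_is_integrable (g G : R -> R) (a b : R) : a < b ->
  measurable_fun setT g -> (forall z, z \in `]a, b[ -> 0 <= g z) ->
  {in `]a, b[, continuous g} -> continuous G ->
  (forall z, z \in `]a, b[ -> is_derive z 1 G (g z)) ->
  mu.-integrable `[a, b] (EFin \o g).
Proof.
move=> ab mg g0 cg cG dG.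
apply/integrableP; split.
  by apply/measurable_EFinP; exact: measurable_funTS.
rewrite integral_itv_bndoo; last first.
  by apply: measurableT_comp => //; apply/measurable_EFinP; exact: measurable_funTS.
have -> : (\int[mu]_(x in `]a, b[) `|(EFin \o g) x| =
           \int[mu]_(x in `]a, b[) (g x)%:E)%E.
  by apply: eq_integral => x; rewrite inE /= => xab; rewrite ger0_norm ?g0.
(* Starting the denominators at 3 keeps [r k] below half the length, so no interval [F k]
   degenerates. *)
pose r (k : nat) : R := (b - a) / k.+3%:R.
pose F k : set (measurableTypeR R) := `[a + r k, b - r k]%classic.
have r0 k : 0 < r k by rewrite divr_gt0 ?subr_gt0.
have rlt k : a + r k < b - r k.
  suff : r k < (b - a) / 2 by lra.
  by rewrite ltr_pM2l ?subr_gt0// ltf_pV2 ?posrE// ltr_nat.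
have FE : \bigcup_k F k = `]a, b[%classic.
  rewrite eqEsubset; split => x /=.
    move=> [k _]; rewrite /F /= !in_itv/= => /andP[h1 h2]; have := r0 k.
    by move=> h; apply/andP; split; lra.
  rewrite in_itv/= => /andP[ax xb].
  pose e := Num.min (x - a) (b - x).
  have e0 : 0 < e by rewrite lt_min !subr_gt0 ax.
  have [k hk] : exists k : nat, (b - a) / e < k%:R.
    by exists (Num.bound ((b - a) / e)); apply: archi_boundP; rewrite divr_ge0 ?subr_ge0 ?ltW.
  exists k => //; rewrite /F/= in_itv/=.
  have rke : r k <= e.
    rewrite /r ler_pdivrMr// mulrC -ler_pdivrMr// (le_trans (ltW hk))//.
    by rewrite ler_nat -addn3 leq_addr.
  move: rke; rewrite /e le_min => /andP[h1 h2].
  by apply/andP; split; lra.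
have ndF : nondecreasing_seq F.
  move=> i j ij; rewrite subsetEset; apply: subset_itv; rewrite bnd_simp.
    rewrite lerD2l ler_pM2l ?subr_gt0// lef_pV2 ?posrE//.
    by rewrite ler_nat !ltnS.
  rewrite lerD2l lerN2 ler_pM2l ?subr_gt0// lef_pV2 ?posrE//.
  by rewrite ler_nat !ltnS.
rewrite -FE.
have cvF : (\int[mu]_(x in F i) (g x)%:E)%E @[i --> \oo] -->
    (\int[mu]_(x in \bigcup_i F i) (g x)%:E)%E.
  apply: ge0_nondecreasing_set_cvg_integral => //.
  - by move=> i; exact: measurable_itv.
  - by move=> i; apply/measurable_EFinP; exact: measurable_funTS.
  - move=> i x Fx; rewrite lee_fin g0//.
    have : (\bigcup_k F k) x by exists i.
    by rewrite FE.
have rcvg : r k @[k --> \oo] --> (0 : R).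
  rewrite -(mulr0 (b - a)); apply: cvgM; first exact: cvg_cst.
  have := @cvg_harmonic R; rewrite -(cvg_shiftn 2).
  by under eq_fun do rewrite /= addn2.
have : (\int[mu]_(x in F i) (g x)%:E)%E @[i --> \oo] --> (G b - G a)%:E.
  rewrite (_ : (fun i => _) = EFin \o (fun i => G (b - r i) - G (a + r i))).
    apply: cvg_EFin; first by apply: nearW.
    have hb : b - r i @[i --> \oo] --> b - 0 by apply: cvgB => //; exact: cvg_cst.
    have ha : a + r i @[i --> \oo] --> a + 0 by apply: cvgD => //; exact: cvg_cst.
    rewrite subr0 in hb; rewrite addr0 in ha.
    by apply: cvgB; [exact: continuous_cvg (cG b) hb | exact: continuous_cvg (cG a) ha].
  apply/funext => i /=; rewrite (FTC_interior cg dG)//.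
    by rewrite ltrDl.
  by rewrite gtrBl.
by move=> /(cvg_unique _ cvF) ->; rewrite ?ltry.
Qed.

Lemma integrable_itvU (g : R -> R) (a b c : R) : a <= b -> b <= c ->
  mu.-integrable `[a, b] (EFin \o g) -> mu.-integrable `[b, c] (EFin \o g) ->
  mu.-integrable `[a, c] (EFin \o g).
Proof.
move=> ab bc i1 i2.
have {}i2 : mu.-integrable `]b, c] (EFin \o g).
  by apply: integrableS i2 => //; apply: subset_itvr; rewrite bnd_simp.
have e : `[a, c]%classic = `[a, b] `|` `]b, c] :> set (measurableTypeR R).
  by rewrite -itv_bndbnd_setU ?bnd_simp.
have /integrableP[m1 f1] := i1; have /integrableP[m2 f2] := i2.
have m : measurable_fun (`[a, b] `|` `]b, c]) (EFin \o g).
  by apply/measurable_funU => //; split.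
apply/integrableP; rewrite e; split => //.
rewrite ge0_integral_setU//; last 2 first.
- exact: measurableT_comp.
- apply/disj_setPS => y [/=]; rewrite 2!in_itv/= => /andP[_ yx] /andP[].
  by rewrite ltNge yx.
exact: lte_add_pinfty.
Qed.

Lemma continuous_sqr_powR (p : R) : 0 < p -> continuous (fun x : R => (x ^+ 2) `^ p).
Proof.
move=> p0 x; have [->|x0] := eqVneq x 0.
  rewrite /continuous_at expr0n/= powR0 ?gt_eqF//.
  apply/cvgrPdist_lt => e e0.
  have /cvgrPdist_lt /(_ e e0) := powR_cvg0 p0.
  move=> -[d /= d0 hd].
  near=> y; have [->|y0] := eqVneq y 0.
    by rewrite expr0n/= powR0 ?gt_eqF// subrr normr0.
  have y2 : 0 < y ^+ 2 by rewrite exprn_even_gt0.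
  apply: (hd (y ^+ 2)) => //=; rewrite sub0r normrN gtr0_norm//.
  (* The bound 1 gives y^2 <= |y|, so that |y| < d suffices for y^2 < d. *)
  have : `|y| < Num.min 1 d.
    near: y; exists (Num.min 1 d); first by rewrite /= lt_min ltr01.
    by move=> z /=; rewrite sub0r normrN.
  rewrite lt_min => /andP[y1 yd]; rewrite -real_normK ?num_real//.
  rewrite expr2 (le_lt_trans _ yd)//.
  by rewrite ler_piMl// ltW.
apply: (@continuous_comp _ _ _ (fun y : R => y ^+ 2) (fun y => y `^ p)).
  exact: exprn_continuous.
apply: differentiable_continuous; apply/derivable1_diffP.
have x2 : 0 < x ^+ 2 by rewrite exprn_even_gt0.
by have h := @is_derive1_powR R p _ x2; exact: ex_derive.
Unshelve. all: by end_near. Qed.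

End FTC.

(** * Integrability of the weight and its product with sin(x/2) *)

Section Weight.
Local Open Scope classical_set_scope.
Local Open Scope ring_scope.
Variable R : realType.
Variables t eta lam : R.
Hypothesis hlam : - (1 / 2) < lam.
Local Notation mu := (@lebesgue_measure R).
Local Notation w := (weight t eta lam).
Let p := lam + 1 / 2.

Lemma p_gt0 : 0 < p. Proof. by rewrite /p; move: hlam; lra. Qed.

Lemma sin_half_gt0 x : x \in `]0, 2 * pi[ -> 0 < sin (x / 2) :> R.
Proof.
rewrite in_itv/= => /andP[x0 x2]; apply: sin_gt0_pi; apply/andP; split; lra.
Qed.

(** This is |sin(x/2)|^(2q). Two exponents matter: [lam] in the weight, possibly negative, and
    [p = lam + 1/2], which is positive. *)
Definition sinpow (q x : R) : R := (sin (x / 2) ^+ 2) `^ q.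

Lemma sinpow_ge0 q x : 0 <= sinpow q x. Proof. exact: powR_ge0. Qed.

Lemma sinpowDhalf q x : x \in `]0, 2 * pi[ ->
  sinpow (q + 1 / 2) x = sinpow q x * sin (x / 2).
Proof.
move=> /sin_half_gt0 s0; rewrite /sinpow powRD; last first.
  by apply/implyP => _; rewrite sqrf_eq0 gt_eqF.
by rewrite mul1r powR12_sqrt ?sqr_ge0// sqrtr_sqr gtr0_norm.
Qed.

Lemma is_derive_half (x : R) : is_derive x 1 (fun y => y / 2) (1 / 2).
Proof.
have -> : (fun y : R => y / 2) = 2^-1 *: id by apply/funext => y /=; rewrite mulrC.
by apply: is_derive_eq; rewrite mulrC.
Qed.

Lemma is_derive_sinpow x : x \in `]0, 2 * pi[ ->
  is_derive x 1 (sinpow p) (p * sinpow lam x * cos (x / 2)).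
Proof.
move=> xI; have s0 := sin_half_gt0 xI.
have d1 := @is_derive1_comp R sin (fun y => y / 2) x _ _ (is_derive_sin _)
  (is_derive_half x).
have s2 : 0 < sin (x / 2) ^+ 2 by rewrite exprn_gt0.
have d2 := is_deriveX 2 d1.
have d3 := @is_derive1_comp R (fun y => y `^ p) _ x _ _ (@is_derive1_powR R p _ s2) d2.
apply: is_derive_eq d3 _ => /=.
have -> : lam = (p - 1) + 1 / 2 by rewrite /p; lra.
by rewrite sinpowDhalf// /sinpow /GRing.scale /= expr1; field.
Qed.

Lemma continuous_sin_half : continuous (fun x : R => sin (x / 2)).
Proof.
move=> x; apply: (@continuous_comp _ _ _ (fun y : R => y / 2) sin).
  exact: mulrr_continuous.
exact: continuous_sin.
Qed.

Lemma continuous_cos_half : continuous (fun x : R => cos (x / 2)).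
Proof.
move=> x; apply: (@continuous_comp _ _ _ (fun y : R => y / 2) cos).
  exact: mulrr_continuous.
exact: continuous_cos.
Qed.

Lemma continuous_sinpow q : 0 < q -> continuous (sinpow q).
Proof.
move=> q0.
have -> : sinpow q = (fun y => (y ^+ 2) `^ q) \o (fun y => sin (y / 2)) by [].
move=> x; apply: continuous_comp; first exact: continuous_sin_half.
exact: continuous_sqr_powR.
Qed.

Let continuous_sin_half_sqr : continuous (fun x : R => sin (x / 2) ^+ 2).
Proof.
move=> x; apply: (@continuous_comp _ _ _ (fun y : R => sin (y / 2)) (fun y => y ^+ 2)).
  exact: continuous_sin_half.
exact: exprn_continuous.
Qed.

Lemma measurable_sinpow q : measurable_fun setT (sinpow q).
Proof.
have -> : sinpow q = (fun y => y `^ q) \o (fun y => sin (y / 2) ^+ 2) by [].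
apply: (measurableT_comp (measurable_powR q)).
exact: continuous_measurable_fun.
Qed.

Lemma continuous_sinpow_itv q : {in `]0, 2 * pi[, continuous (sinpow q)}.
Proof.
move=> x /sin_half_gt0 s0.
have -> : sinpow q = (fun y => y `^ q) \o (fun y => sin (y / 2) ^+ 2) by [].
apply: continuous_comp; first exact: continuous_sin_half_sqr.
have s2 : 0 < sin (x / 2) ^+ 2 by rewrite exprn_gt0.
apply: differentiable_continuous; apply/derivable1_diffP.
by have h := @is_derive1_powR R q _ s2; exact: ex_derive.
Qed.

Let dsinpow (x : R) := p * sinpow lam x * cos (x / 2).

Let measurable_dsinpow : measurable_fun setT dsinpow.
Proof.
apply: measurable_funM; last by apply: continuous_measurable_fun; exact: continuous_cos_half.
by apply: measurable_funM => //; exact: measurable_sinpow.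
Qed.

Let continuous_dsinpow : {in `]0, 2 * pi[, continuous dsinpow}.
Proof.
move=> x xI; apply: cvgM; last exact: continuous_cos_half.
by apply: cvgM; [exact: cvg_cst | exact: continuous_sinpow_itv].
Qed.

Let pi0 : 0 < (pi : R). Proof. exact: pi_gt0. Qed.

(** The sign of [dsinpow] is that of cos(x/2), which changes at pi; on each half, [dsinpow] or its
    opposite is a nonnegative derivative of a continuous function. *)
Let integrable_dsinpow : mu.-integrable `[0, 2 * pi] (EFin \o dsinpow).
Proof.
have iL : mu.-integrable `[0, pi] (EFin \o dsinpow).
  have sub x : x \in `]0, pi[ -> x \in `]0, 2 * (pi : R)[.
    by rewrite !in_itv/= => /andP[x0 xpi]; apply/andP; split=> //; lra.
  apply: (@ge0_FTC_is_integrable _ _ (sinpow p)) => //.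
  - move=> x /[dup] /sub xI; rewrite in_itv/= => /andP[x0 xpi].
    rewrite /dsinpow !mulr_ge0 ?sinpow_ge0 ?ltW ?p_gt0//.
    by apply: cos_gt0_pihalf; apply/andP; split; lra.
  - by move=> x /sub; exact: continuous_dsinpow.
  - by apply: continuous_sinpow; exact: p_gt0.
  - by move=> x /sub; exact: is_derive_sinpow.
have iR : mu.-integrable `[pi, 2 * pi] (EFin \o (fun x => - dsinpow x)).
  have sub x : x \in `]pi, 2 * pi[ -> x \in `]0, 2 * (pi : R)[.
    by rewrite !in_itv/= => /andP[h ->]; rewrite (lt_trans _ h).
  apply: (@ge0_FTC_is_integrable _ _ (fun x => - sinpow p x)) => //.
  - by move: pi0; lra.
  - exact: measurableT_comp.
  - move=> x /[dup] /sub xI; rewrite in_itv/= => /andP[x0 xpi].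
    rewrite /dsinpow -mulrN mulr_ge0//.
      by rewrite mulr_ge0 ?sinpow_ge0// ltW// p_gt0.
    have -> : x / 2 = (x - pi) / 2 + pi / 2 by lra.
    by rewrite cosDpihalf opprK sin_ge0_pi//; apply/andP; split; lra.
  - by move=> x /sub xI; apply: cvgN; exact: continuous_dsinpow.
  - by move=> x; apply: cvgN; apply: continuous_sinpow; exact: p_gt0.
  - move=> x /sub xI; have h := is_derive_sinpow xI.
    by apply: is_derive_eq.
apply: (@integrable_itvU _ _ 0 pi); [by rewrite ltW | by move: pi0; lra | exact: iL |].
have := integrableN iR; apply: eq_integrable => // x _ /=.
by rewrite opprK.
Qed.

(* |sin|^(2 lam) = |sin|^(2 lam) (cos^2 + sin^2) <= |sin|^(2 lam) |cos| + 1, and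
   |sin|^(2 lam) cos is up to a factor the derivative of |sin|^(2 lam + 1). *)
Lemma integrable_sinpow : mu.-integrable `[0, 2 * pi] (EFin \o sinpow lam).
Proof.
have i1 : mu.-integrable `[0, 2 * pi] (EFin \o (fun x => `|dsinpow x|)).
  exact: integrable_abse integrable_dsinpow.
have i2 : mu.-integrable `[0, 2 * pi] (EFin \o cst (1 : R)).
  by apply: continuous_compact_integrable; [exact: segment_compact|
    apply: continuous_subspaceT => x; exact: cvg_cst].
have i3 : mu.-integrable `[0, 2 * pi] (EFin \o (fun x => p^-1 * `|dsinpow x| + 1)).
  by apply: (integrableD _ (integrableZl _ p^-1 i1) i2).
apply: le_integrable i3 => //.

- by apply/measurable_EFinP/measurable_funTS; exact: measurable_sinpow.
- move=> x _ /=; rewrite lee_fin [leLHS]ger0_norm ?sinpow_ge0//.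
  rewrite ger0_norm; last by rewrite addr_ge0// mulr_ge0// invr_ge0 ltW// p_gt0.
  rewrite /dsinpow !normrM (gtr0_norm p_gt0) (ger0_norm (sinpow_ge0 _ _)) -mulrA.
  rewrite mulKf ?gt_eqF ?p_gt0//.
  set v := sinpow lam x; set c := cos (x / 2).
  have v0 : 0 <= v := sinpow_ge0 _ _.
  have c1 : `|c| <= 1 by exact: cos_max.
  have hs : v * sin (x / 2) ^+ 2 <= 1.
    rewrite /v /sinpow; set u := sin (x / 2) ^+ 2.
    have u0 : 0 <= u by exact: sqr_ge0.
    have u1 : u <= 1.
      by rewrite /u sin2cos2 gerBl sqr_ge0.
    move: u0; rewrite le_eqVlt => /predU1P[<-|u0]; first by rewrite mulr0.
    rewrite -[X in _ * X](powRr1 (ltW u0)) -powRD ?(gt_eqF u0) ?implybT//.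
    rewrite -[leRHS](powRr0 u) ger_powR// ?u0//; move: hlam; lra.
  have e : v = v * c ^+ 2 + v * sin (x / 2) ^+ 2.
    by rewrite -mulrDr cos2Dsin2 mulr1.
  rewrite [leLHS]e.
  apply: lerD => //; rewrite ler_wpM2l// -real_normK ?num_real// expr2.
  by rewrite ler_piMl.
Qed.

Lemma weightE x : weight t eta lam x =
  expR (t * cos x) * expR (- (eta * x)) * sinpow lam x.
Proof. by []. Qed.

Let expw x := expR (t * cos x) * expR (- (eta * x)).

Let continuous_expw : continuous expw.
Proof.
move=> x; apply: cvgM.
  apply: (@continuous_comp _ _ _ (fun y : R => t * cos y) expR); last exact: continuous_expR.
  by apply: cvgM; [exact: cvg_cst | exact: continuous_cos].
apply: (@continuous_comp _ _ _ (fun y : R => - (eta * y)) expR); last exact: continuous_expR.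
by apply: cvgN; apply: cvgM; [exact: cvg_cst | exact: cvg_id].
Qed.

Lemma integrableM_continuous (k f : R -> R) (a b : R) : continuous k ->
  mu.-integrable `[a, b] (EFin \o f) ->
  mu.-integrable `[a, b] (EFin \o (fun x => k x * f x)).
Proof.
move=> ck intf.
suff : mu.-integrable `[a, b] ((EFin \o k) \* (EFin \o f))%E.
  by apply: eq_integrable => // x _ /=; rewrite EFinM.
apply: integrableMr => //.
  by apply: measurable_funTS; exact: continuous_measurable_fun.
have ckab : {within `[a, b], continuous k} by exact: continuous_subspaceT.
have /compact_bounded[M [Mr Mk]] := continuous_compact ckab (segment_compact (a:=a) (b:=b)).
exists M; split=> // r Mr' x /= xab; apply: Mk => //; exists x => //.
Qed.

Lemma integrable_weight : mu.-integrable `[0, 2 * pi] (EFin \o weight t eta lam).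
Proof.
exact: (integrableM_continuous continuous_expw integrable_sinpow).
Qed.

Lemma weight_gt0 x : x \in `]0, 2 * pi[ -> 0 < weight t eta lam x.
Proof.
move=> /sin_half_gt0 s0; rewrite weightE mulr_gt0 ?mulr_gt0 ?expR_gt0//.
by rewrite powR_gt0// exprn_gt0.
Qed.

Lemma weight_ge0 x : 0 <= weight t eta lam x.
Proof. by rewrite weightE !mulr_ge0 ?expR_ge0 ?sinpow_ge0. Qed.

Lemma continuous_weight : {in `]0, 2 * pi[, continuous (weight t eta lam)}.
Proof.
move=> x xI; apply: cvgM; first exact: continuous_expw.
exact: continuous_sinpow_itv.
Qed.

(* On ]0, 2 pi[ this is sin (x / 2) times the weight, see [potentialE]; unlike that
   product it is visibly continuous up to the endpoints, where it is 0. *)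
Definition potential x := expw x * sinpow p x.

Lemma continuous_potential : continuous potential.
Proof.
move=> x; apply: cvgM; first exact: continuous_expw.
by apply: continuous_sinpow; exact: p_gt0.
Qed.

Lemma potentialE x : x \in `]0, 2 * pi[ ->
  potential x = weight t eta lam x * sin (x / 2).
Proof. by move=> xI; rewrite /potential /p sinpowDhalf// mulrA. Qed.

Lemma potential0 : potential 0 = 0.
Proof.
by rewrite /potential /sinpow mul0r sin0 expr0n/= powR0 ?mulr0// gt_eqF// p_gt0.
Qed.

Lemma potential2pi : potential (2 * pi) = 0.
Proof.
have -> : potential (2 * pi) = expw (2 * pi) * (sin pi ^+ 2) `^ p.
  have e : 2 * pi / 2 = pi :> R by field.
  by rewrite /potential /sinpow e.
by rewrite sinpi expr0n/= powR0 ?mulr0// gt_eqF// p_gt0.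
Qed.

(** The logarithmic derivative of the weight is - t sin x - eta + lam cot(x/2); multiplied by
    sin(x/2) it contributes lam cos(x/2), and the extra sine factor contributes cos(x/2)/2, whence
    the constant [p]. *)
Lemma is_derive_potential x : x \in `]0, 2 * pi[ ->
  is_derive x 1 potential (weight t eta lam x *
    ((- t * sin x - eta) * sin (x / 2) + p * cos (x / 2))).
Proof.
move=> xI.
have d1 : is_derive x 1 (fun y : R => t * cos y) (t * - sin x).
  exact: is_deriveZ.
have d2 : is_derive x 1 (fun y : R => - (eta * y)) (- eta).
  have h : is_derive x 1 (fun y : R => eta * y) (eta *: (1 : R)).
    exact: is_deriveZ.
  by have := is_deriveN h; rewrite /GRing.scale /= mulr1.
have e1 := @is_derive1_comp R expR _ x _ _ (is_derive_expR _) d1.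
have e2 := @is_derive1_comp R expR _ x _ _ (is_derive_expR _) d2.
have e3 := is_deriveM (is_deriveM e1 e2) (is_derive_sinpow xI).
apply: is_derive_eq e3 _.
rewrite weightE /GRing.scale /= /p sinpowDhalf// -/p. 
by rewrite !fctE /=; ring.
Qed.

End Weight.

(** * Complex-valued functions of the angle *)

Section ComplexCalculus.
Local Open Scope classical_set_scope.
Local Open Scope ring_scope.
Variable R : realType.
Local Notation C := R[i].
Local Notation Re := (@complex.Re R).
Local Notation Im := (@complex.Im R).
Local Notation I := ((0 : R) +i* 1)%C.

Lemma ReM (x y : C) : Re (x * y) = Re x * Re y - Im x * Im y.
Proof. by case: x; case: y. Qed.

Lemma ImM (x y : C) : Im (x * y) = Re x * Im y + Im x * Re y.
Proof. by case: x; case: y. Qed.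

Lemma ReD (x y : C) : Re (x + y) = Re x + Re y.
Proof. by case: x; case: y. Qed.

Lemma ImD (x y : C) : Im (x + y) = Im x + Im y.
Proof. by case: x; case: y. Qed.

Lemma Re_conj (x : C) : Re x^* = Re x.
Proof. by rewrite conj_complexE. Qed.

Lemma Im_conj (x : C) : Im x^* = - Im x.
Proof. by rewrite conj_complexE. Qed.

Lemma complex_ext (x y : C) : Re x = Re y -> Im x = Im y -> x = y.
Proof. by case: x y => [a b] [c d] /= -> ->. Qed.

Lemma sqrI : I * I = -1 :> C.
Proof. by apply: complex_ext; rewrite ?ReM ?ImM /=; ring. Qed.

Lemma conjI : I^* = - I :> C.
Proof. by apply: complex_ext; rewrite ?Re_conj ?Im_conj /=; ring. Qed.

Lemma expi_unit (x : R) : expi x * (expi x)^* = 1.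
Proof.
apply: complex_ext; rewrite ?ReM ?ImM ?Re_conj ?Im_conj /=; last by ring.
by rewrite mulrN opprK -!expr2 cos2Dsin2.
Qed.

Definition ccontinuous (F : R -> C) :=
  continuous (fun x => Re (F x)) /\ continuous (fun x => Im (F x)).

Lemma ccontinuous_cst (z : C) : ccontinuous (fun=> z).
Proof. by split=> x; exact: cvg_cst. Qed.

Lemma ccontinuousD F G : ccontinuous F -> ccontinuous G ->
  ccontinuous (fun x => F x + G x).
Proof.
move=> [rF iF] [rG iG]; split=> x.
  under eq_fun do rewrite ReD.
  by apply: cvgD; [exact: rF | exact: rG].
under eq_fun do rewrite ImD.
by apply: cvgD; [exact: iF | exact: iG].
Qed.

Lemma ccontinuousM F G : ccontinuous F -> ccontinuous G ->
  ccontinuous (fun x => F x * G x).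
Proof.
move=> [rF iF] [rG iG]; split=> x.
  under eq_fun do rewrite ReM.
  by apply: cvgB; apply: cvgM; [exact: rF|exact: rG|exact: iF|exact: iG].
under eq_fun do rewrite ImM.
by apply: cvgD; apply: cvgM; [exact: rF|exact: iG|exact: iF|exact: rG].
Qed.

Lemma ccontinuousC F : ccontinuous F -> ccontinuous (fun x => (F x)^*).
Proof.
move=> [rF iF]; split=> x.
  under eq_fun do rewrite Re_conj.
  exact: rF.
under eq_fun do rewrite Im_conj.
by apply: cvgN; exact: iF.
Qed.

Lemma ccontinuous_real (f : R -> R) : continuous f ->
  ccontinuous (fun x => (f x)%:C%C).
Proof. by move=> cf; split=> x //=; exact: cvg_cst. Qed.

(** The variable is the real angle and the circle integral is taken componentwise, so
    differentiation is componentwise too. *)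
Definition cderive (F dF : R -> C) := forall x : R,
  is_derive x (1 : R) (fun y => Re (F y)) (Re (dF x)) /\
  is_derive x (1 : R) (fun y => Im (F y)) (Im (dF x)).

Lemma cderive_ccontinuous F dF : cderive F dF -> ccontinuous F.
Proof.
move=> dFE; split=> x; have [rF iF] := dFE x;
  by apply: differentiable_continuous; apply/derivable1_diffP; exact: ex_derive.
Qed.

Lemma cderive_eq F dF dF' : cderive F dF -> dF =1 dF' -> cderive F dF'.
Proof. by move=> h e x; rewrite -e. Qed.

Lemma cderive_cst z : cderive (fun=> z) (fun=> 0).
Proof. by move=> x; split; exact: is_derive_cst. Qed.

Lemma cderiveD F G dF dG : cderive F dF -> cderive G dG ->
  cderive (fun x => F x + G x) (fun x => dF x + dG x).
Proof.
move=> hF hG x; have [rF iF] := hF x; have [rG iG] := hG x.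
split.
  under eq_fun do rewrite ReD.
  by rewrite ReD; exact: is_deriveD.
under eq_fun do rewrite ImD.
by rewrite ImD; exact: is_deriveD.
Qed.

Lemma cderiveM F G dF dG : cderive F dF -> cderive G dG ->
  cderive (fun x => F x * G x) (fun x => dF x * G x + F x * dG x).
Proof.
move=> hF hG x; have [rF iF] := hF x; have [rG iG] := hG x.
split.
  under eq_fun do rewrite ReM.
  apply: is_derive_eq (is_deriveB (is_deriveM rF rG) (is_deriveM iF iG)) _.
  rewrite /GRing.scale /= ReD !ReM; ring.
under eq_fun do rewrite ImM.
apply: is_derive_eq (is_deriveD (is_deriveM rF iG) (is_deriveM iF rG)) _.
rewrite /GRing.scale /= ImD !ImM; ring.
Qed.

Lemma cderiveC F dF : cderive F dF ->
  cderive (fun x => (F x)^*) (fun x => (dF x)^*).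
Proof.
move=> hF x; have [rF iF] := hF x; split.
  under eq_fun do rewrite Re_conj.
  by rewrite Re_conj.
under eq_fun do rewrite Im_conj.
by rewrite Im_conj; exact: is_deriveN.
Qed.

Lemma cderive_expi : cderive (@expi R) (fun x => I * expi x).
Proof.
move=> x; rewrite ReM ImM /=; split.
  by apply: is_derive_eq (is_derive_cos x) _; ring.
by apply: is_derive_eq (is_derive_sin x) _; ring.
Qed.

Lemma cderive_expi_half :
  cderive (fun x => expi (x / 2)) (fun x => I * (1 / 2)%:C%C * expi (x / 2)).
Proof.
move=> x; rewrite !ReM !ImM /=; split.
  apply: is_derive_eq (@is_derive1_comp R cos (fun y => y / 2) x _ _ (is_derive_cos _)
    (is_derive_half x)) _; ring.
apply: is_derive_eq (@is_derive1_comp R sin (fun y => y / 2) x _ _ (is_derive_sin _)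
  (is_derive_half x)) _; ring.
Qed.

Lemma cderive_horner (f : {poly C}) :
  cderive (fun x => f.[expi x]) (fun x => I * expi x * f^`().[expi x]).
Proof.
elim/poly_ind: f => [|f c IHf].
  apply: cderive_eq (_ : cderive _ (fun=> 0)) _.
    under eq_fun do rewrite horner0.
    exact: cderive_cst.
  by move=> x; rewrite deriv0 horner0 mulr0.
under eq_fun do rewrite hornerMXaddC.
apply: cderive_eq (cderiveD (cderiveM IHf cderive_expi) (cderive_cst c)) _ => x.
by rewrite derivMXaddC hornerD hornerM hornerX; ring.
Qed.

Lemma ccontinuous_horner (f : {poly C}) : ccontinuous (fun x => f.[expi x]).
Proof. exact: cderive_ccontinuous (cderive_horner f). Qed.

End ComplexCalculus.

(** * The inner product of the weight: Pearson identity and definiteness *)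

Section WeightedIntegral.
Local Open Scope classical_set_scope.
Local Open Scope ring_scope.
Variable R : realType.
Variables t eta lam : R.
Hypothesis hlam : - (1 / 2) < lam.
Local Notation C := R[i].
Local Notation mu := (@lebesgue_measure R).
Local Notation Re := (@complex.Re R).
Local Notation Im := (@complex.Im R).
Local Notation w := (weight t eta lam).
Local Notation p := (lam + 1 / 2).

(** General integrands are needed because integration by parts produces sin(x/2) and e^(ix/2), which
    are not polynomials in e^(ix). *)
Definition wint (K : R -> C) : C :=
  circle_integral (fun x => K x * (w x)%:C%C).

Lemma wintE K : wint K =
  ((\int[mu]_(x in `[0, 2 * pi]) (Re (K x) * w x)) +i*
   (\int[mu]_(x in `[0, 2 * pi]) (Im (K x) * w x)))%C.
Proof.
rewrite /wint /circle_integral; congr (_ +i* _)%C; apply: eq_Rintegral => x _.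
  by rewrite ReM /= mulr0 subr0.
by rewrite ImM /= mulr0 add0r.
Qed.

Lemma integrable_continuousM (k : R -> R) : continuous k ->
  mu.-integrable `[0, 2 * pi] (EFin \o (fun x => k x * w x)).
Proof.
by move=> ck; apply: integrableM_continuous => //; exact: integrable_weight.
Qed.

Lemma eq_wint K L : K =1 L -> wint K = wint L.
Proof. by move=> /funext ->. Qed.

Lemma wintD K L : ccontinuous K -> ccontinuous L ->
  wint (fun x => K x + L x) = wint K + wint L.
Proof.
move=> [rK iK] [rL iL]; rewrite !wintE; apply: complex_ext => /=.
  rewrite -RintegralD//; try exact: integrable_continuousM.
  by apply: eq_Rintegral => x _; rewrite ReD mulrDl.
rewrite -RintegralD//; try exact: integrable_continuousM.
by apply: eq_Rintegral => x _; rewrite ImD mulrDl.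
Qed.

Lemma wintZ z K : ccontinuous K -> wint (fun x => z * K x) = z * wint K.
Proof.
move=> [rK iK]; rewrite !wintE.
have iZ (k : R -> R) (r : R) : continuous k ->
    mu.-integrable `[0, 2 * pi] (EFin \o (fun x => r * (k x * w x))).
  move=> ck; have crk : continuous (fun x => r * k x).
    by move=> x; apply: cvgM; [exact: cvg_cst|exact: ck].
  have := integrable_continuousM crk.
  by apply: eq_integrable => // x _ /=; rewrite mulrA.
apply: complex_ext; rewrite ?ReM ?ImM /=.
  rewrite -!RintegralZl//; try exact: integrable_continuousM.
  rewrite -RintegralB//; try exact: iZ.
  by apply: eq_Rintegral => x _; rewrite ReM; ring.
rewrite -!RintegralZl//; try exact: integrable_continuousM.
rewrite -RintegralD//; try exact: iZ.
by apply: eq_Rintegral => x _; rewrite ImM; ring.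
Qed.

Lemma wint_conj K : ccontinuous K -> wint (fun x => (K x)^*) = (wint K)^*.
Proof.
move=> [rK iK]; rewrite !wintE; apply: complex_ext; rewrite ?Re_conj ?Im_conj /=.
  by apply: eq_Rintegral => x _; rewrite Re_conj.
rewrite -mulN1r -RintegralZl//; last exact: integrable_continuousM.
by apply: eq_Rintegral => x _; rewrite Im_conj mulN1r mulNr.
Qed.

(* This is the derivative of [potential * l]. *)
Lemma Rintegral_potential (l dl : R -> R) :
  (forall x, is_derive x (1 : R) l (dl x)) -> continuous dl ->
  \int[mu]_(x in `[0, 2 * pi])
    ((((- t * sin x - eta) * sin (x / 2) + p * cos (x / 2)) * l x
      + sin (x / 2) * dl x) * w x) = 0.
Proof.
move=> hl cdl.
have cl : continuous l.
  move=> x; have hx := hl x.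
  by apply: differentiable_continuous; apply/derivable1_diffP; exact: ex_derive.
have ck : continuous (fun x => ((- t * sin x - eta) * sin (x / 2) + p * cos (x / 2)) * l x
      + sin (x / 2) * dl x).
  move=> x; apply: cvgD; apply: cvgM; [|exact: cl|exact: continuous_sin_half|exact: cdl].
  apply: cvgD; apply: cvgM; [|exact: continuous_sin_half|exact: cvg_cst|exact: continuous_cos_half].
  by apply: cvgB; [apply: cvgM; [exact: cvg_cst|exact: continuous_sin]|exact: cvg_cst].
pose V := potential t eta lam.
transitivity (V (2 * pi) * l (2 * pi) - V 0 * l 0); last first.
  by rewrite /V potential2pi// potential0// !mul0r subrr.
apply: (@FTC_integrable R _ (fun x => V x * l x)).
- by rewrite mulr_gt0// pi_gt0.
- exact: integrable_continuousM.
- move=> x xI; apply: cvgM; first exact: ck.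
  exact: continuous_weight.
- by move=> x; apply: cvgM; [exact: continuous_potential|exact: cl].
move=> x xI; have dV := is_derive_potential t eta lam xI.
apply: is_derive_eq (is_deriveM dV (hl x)) _.
by rewrite /GRing.scale /= potentialE//; ring.
Qed.

Lemma wint_potential (L dL : R -> C) : cderive L dL -> ccontinuous dL ->
  wint (fun x => ((- t * sin x - eta) * sin (x / 2) + p * cos (x / 2))%:C%C * L x
                 + (sin (x / 2))%:C%C * dL x) = 0.
Proof.
move=> hL [rdL idL]; rewrite wintE; apply: complex_ext => /=.
  rewrite -[RHS](Rintegral_potential (fun x => (hL x).1) rdL).
  by apply: eq_Rintegral => x _; rewrite ReD !ReM /= !mul0r !subr0.
rewrite -[RHS](Rintegral_potential (fun x => (hL x).2) idL).
by apply: eq_Rintegral => x _; rewrite ImD !ImM /= !mul0r !addr0.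
Qed.

Local Notation ip := (circle_inner w).

Lemma ipE f g : ip f g = wint (fun x => f.[expi x] * (g.[expi x])^*).
Proof. by []. Qed.

Let cfg (f g : {poly C}) : ccontinuous (fun x => f.[expi x] * (g.[expi x])^*).
Proof.
apply: ccontinuousM; first exact: ccontinuous_horner.
by apply: ccontinuousC; exact: ccontinuous_horner.
Qed.

Lemma circle_innerDl f g h : ip (f + g) h = ip f h + ip g h.
Proof.
rewrite !ipE -wintD; [|exact: cfg..].
by apply: eq_wint => x; rewrite hornerD mulrDl.
Qed.

Lemma circle_innerZl c f h : ip (c *: f) h = c * ip f h.
Proof.
rewrite !ipE -wintZ; last exact: cfg.
by apply: eq_wint => x; rewrite hornerZ mulrA.
Qed.

Lemma circle_inner_herm f g : ip g f = (ip f g)^*.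
Proof.
rewrite !ipE -wint_conj; last exact: cfg.
by apply: eq_wint => x; rewrite rmorphM /= conjCK mulrC.
Qed.

Lemma circle_innerXX f g : ip ('X * f) ('X * g) = ip f g.
Proof.
rewrite !ipE; apply: eq_wint => x; rewrite !hornerM !hornerX rmorphM /=.
by rewrite mulrACA expi_unit mul1r.
Qed.

(** [wint_potential] is applied to e^(ix/2) f conj(g): since z - 1 = 2 i e^(ix/2) sin(x/2), its
    product with the potential is a constant multiple of (z - 1) f conj(g) w. The factor t cos x of
    the exponent gives t sin x = - i T (z - 1/z); the part with 1/z is not polynomial in z and is
    moved to the second argument, as [ip f ('X * g)]. *)
Lemma circle_inner_pearson (f g : {poly C}) (b := (lam +i* eta)%C) (T := (t / 2)%:C%C) :
  ip ('X * ('X - 1) * f^`() + (b + 1) *: ('X * f) + b^* *: f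
      + T *: ('X ^+ 2 * f - 'X * f - f)) g + T * ip f ('X * g)
  = ip (('X - 1) * f) ('X * g^`()).
Proof.
pose i0 : C := 'i%C.
pose F x := f.[expi x] * (g.[expi x])^*.
have dF := cderiveM (cderive_horner f) (cderiveC (cderive_horner g)).
have dL := cderiveM (@cderive_expi_half R) dF.
have cL : ccontinuous (fun x : R => expi (x / 2)).
  exact: cderive_ccontinuous (@cderive_expi_half R).
have cE : ccontinuous (@expi R) by exact: cderive_ccontinuous (@cderive_expi R).
have cc z := @ccontinuous_cst R z.
have ch := @ccontinuous_horner R.
have cF : ccontinuous F := cfg f g.
have cdF : ccontinuous (fun x => i0 * expi x * f^`().[expi x] * (g.[expi x])^*
     + f.[expi x] * (i0 * expi x * g^`().[expi x])^*).
  exact: ccontinuousD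
    (ccontinuousM (ccontinuousM (ccontinuousM (cc _) cE) (ch _)) (ccontinuousC (ch _)))
    (ccontinuousM (ch _) (ccontinuousC (ccontinuousM (ccontinuousM (cc _) cE) (ch _)))).
have cdL : ccontinuous (fun x => i0 * (1 / 2)%:C%C * expi (x / 2) * F x + expi (x / 2) *
    (i0 * expi x * f^`().[expi x] * (g.[expi x])^*
     + f.[expi x] * (i0 * expi x * g^`().[expi x])^*)).
  exact: ccontinuousD (ccontinuousM (ccontinuousM (cc _) cL) cF)
    (ccontinuousM cL cdF).
have cs : continuous (@sin R) by exact: continuous_sin.
have csh := @continuous_sin_half R; have cch := @continuous_cos_half R.
(* The factor 2 lets the half-angle terms be replaced by polynomials in z, through 2 sin(x/2)
   e^(ix/2) = - i (z - 1) and 2 cos(x/2) e^(ix/2) = z + 1. *)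
have K0 := congr1 (fun z => 2 * z) (wint_potential dL cdL).
have ck : continuous (fun x => (- t * sin x - eta) * sin (x / 2) + p * cos (x / 2)).
  move=> x; apply: cvgD; apply: cvgM; [|exact: csh|exact: cvg_cst|exact: cch].
  by apply: cvgB; [apply: cvgM; [exact: cvg_cst|exact: cs]|exact: cvg_cst].
rewrite mulr0 -wintZ in K0; last first.
  exact: ccontinuousD (ccontinuousM (ccontinuous_real ck) (ccontinuousM cL cF))
    (ccontinuousM (ccontinuous_real csh) cdL).
have move_eq (A B D : C) : A + B + (-1) * D = 0 -> A + B = D.
  by move/eqP; rewrite mulN1r subr_eq0 => /eqP.
apply: move_eq; rewrite !ipE.
rewrite -!wintZ; [|exact: cfg..].
rewrite -wintD; [|exact: cfg|exact: ccontinuousM (cc _) (cfg _ _)].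
rewrite -wintD; [|exact: ccontinuousD (cfg _ _) (ccontinuousM (cc _) (cfg _ _))
  |exact: ccontinuousM (cc _) (cfg _ _)].
rewrite -[RHS]K0; apply: eq_wint => x.
pose u := expi (x / 2); pose e := expi x; pose ei := e^*.
have ee : e * ei = 1 by exact: expi_unit.
have ii : i0 * i0 = -1 by exact: sqrI.
have eu : e = u * u.
  by apply: complex_ext; rewrite ?ReM ?ImM /= {1}(splitr x) ?cosD ?sinD; ring.
have two : 2 = (2 : R)%:C%C :> C by rewrite rmorph_nat.
have cs1 : cos (x / 2) ^+ 2 = 1 - sin (x / 2) ^+ 2 by rewrite cos2sin2.
have S1 : 2 * (sin (x / 2))%:C%C * u = - i0 * (e - 1).
  by rewrite eu two; apply: complex_ext;
    rewrite !(mulNr, ReD, ImD, ReM, ImM) /=; ring: cs1.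
have S2 : 2 * (cos (x / 2))%:C%C * u = e + 1.
  by rewrite eu two; apply: complex_ext;
    rewrite !(mulNr, ReD, ImD, ReM, ImM) /=; ring: cs1.
have S3 : 2 * (sin x)%:C%C = - i0 * (e - ei).
  by rewrite two; apply: complex_ext; rewrite !(mulNr, ReD, ImD, ReM, ImM) /=; ring.
pose H : C := (1 / 2)%:C%C.
have HH : 1 = H + H by apply: complex_ext => /=; [field|ring].
have bE : b + 1 = lam%:C%C + eta%:C%C * i0 + (H + H).
  by rewrite -HH; congr (_ + 1); apply: complex_ext; rewrite ?(ReD, ImD, ReM, ImM) /=; ring.
have bcE : b^* = lam%:C%C - eta%:C%C * i0.
  by apply: complex_ext; rewrite ?(Re_conj, Im_conj, ReD, ImD) /=; ring.
have rE : ((- t * sin x - eta) * sin (x / 2) + p * cos (x / 2))%:C%C =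
    (- (T + T) * (sin x)%:C%C - eta%:C%C) * (sin (x / 2))%:C%C
    + (lam%:C%C + H) * (cos (x / 2))%:C%C :> C.
  apply: complex_ext; rewrite ?(ReD, ImD, ReM, ImM) /=; first by field.
  ring.
rewrite bE bcE rE -/H !(hornerD, hornerM, hornerZ, hornerN, hornerX, hornerC, hornerXn).
rewrite !rmorphM /= conjI -/i0 -/e -/ei -/u.
move: (f.[e]) (g.[e]^*) (f^`().[e]) (g^`().[e]^*) => f0 g0 f1 g1.
transitivity ((- T * (2 * (sin x)%:C%C) - eta%:C%C) * (2 * (sin (x / 2))%:C%C * u) * (f0 * g0)
  + (lam%:C%C + H) * (2 * (cos (x / 2))%:C%C * u) * (f0 * g0)
  + (2 * (sin (x / 2))%:C%C * u) *
    (i0 * H * (f0 * g0) + (i0 * e * f1 * g0 - f0 * (i0 * ei * g1)))); last by ring.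
rewrite S1 S2 S3.
ring: ii ee.
Qed.

Lemma finite_roots (f : {poly C}) : f != 0 -> finite_set [set z | root f z].
Proof.
have [rs rsE] := closed_field_poly_normal f => f0.
apply: (sub_finite_set (B := [set` rs])); last exact: finite_seq.
move=> z /=; rewrite rsE rootZ ?lead_coef_eq0//.
by rewrite root_prod_XsubC.
Qed.

(** A vanishing integral forces |f|^2 w = 0 almost everywhere. As w > 0 inside the interval and a
    nonzero f has finitely many roots, ]0, pi[ would then be covered by a null set. *)
Lemma circle_inner_definite f : ip f f = 0 -> f = 0.
Proof.
move=> ff0; apply/eqP/negPn/negP => f0.
pose k x := Re (f.[expi x]) ^+ 2 + Im (f.[expi x]) ^+ 2.
have [rc ic] := ccontinuous_horner f.
have ck : continuous k.
  move=> x; apply: cvgD; rewrite expr2; apply: cvgM; [exact: rc|exact: rc|exact: ic|exact: ic].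
have k0 x : 0 <= k x by rewrite addr_ge0 ?sqr_ge0.
have int0 : \int[mu]_(x in `[0, 2 * pi]) (k x * w x) = 0.
  move: ff0; rewrite ipE wintE => /(congr1 Re) /= e; rewrite -[RHS]e.
  by apply: eq_Rintegral => x _; rewrite ReM Re_conj Im_conj mulrN opprK -!expr2.
have ik : mu.-integrable `[0, 2 * pi] (EFin \o (fun x => k x * w x)).
  exact: integrable_continuousM.
have aint0 : (\int[mu]_(x in `[0%R, (2 * pi)%R]) `|(k x * w x)%:E| = 0)%E.
  have -> : (\int[mu]_(x in `[0%R, (2 * pi)%R]) `|(k x * w x)%:E| =
             \int[mu]_(x in `[0%R, (2 * pi)%R]) (k x * w x)%:E)%E.
    by apply: eq_integral => x _; rewrite /= ger0_norm// mulr_ge0// weight_ge0.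
  rewrite -[LHS]fineK; last exact: integrable_fin_num.
  by rewrite -/(Rintegral mu _ _) int0.
have [N [mN N0 subN]] : ae_eq mu `[0, 2 * pi]%classic (EFin \o (fun x => k x * w x)) (cst 0%E).
  by apply/ae_eq_integral_abs => //; exact: measurable_int ik.
(* The upper half circle is enough, and there the angle is recovered from the point as the [acos] of
   its real part, so finitely many roots give finitely many angles. *)
pose Z := [set x | x \in `[0, pi] /\ root f (expi x)].
have finZ : finite_set Z.
  apply: (sub_finite_set (B := [set acos (Re z) | z in [set z | root f z]])).
    move=> x [xI rx] /=; exists (expi x) => //=; exact: cosK.
  exact: finite_image (finite_roots f0).
have Z0 : mu Z = 0%E by apply: countable_lebesgue_measure0; exact: finite_set_countable.
have sub : `]0, pi[%classic `<=` Z `|` N.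
  move=> x /= xI.
  have [kx|kx] := eqVneq (k x) 0.
    left; split; first exact: subset_itv_oo_cc xI.
    move: kx => /eqP; rewrite paddr_eq0 ?sqr_ge0// !sqrf_eq0 => /andP[/eqP r0 /eqP i0].
    by apply/eqP; exact: complex_ext.
  right; apply: subN => /=; apply/not_implyP.
  have xI2 : x \in `]0, 2 * pi[.
    by move: xI; rewrite !in_itv/= => /andP[-> xpi] /=; have := pi_gt0 R; lra.
  split; first by exact: subset_itv_oo_cc xI2.
  move=> [] /eqP; rewrite mulf_eq0 (negPf kx)/= gt_eqF//.
  by apply: weight_gt0.
have mZ : measurable Z.
  by apply: countable_measurable; [move=> z; exact: measurable_set1|exact: finite_set_countable].
have : (mu `]0%R, (pi : R)[ <= mu (Z `|` N))%E.
  by apply: le_measure => //; rewrite inE//; exact: measurableU.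
rewrite measureU0// => h.
have : (mu `]0%R, (pi : R)[ <= 0)%E by rewrite -Z0; exact: h.
rewrite lebesgue_measure_itv/= lte_fin pi_gt0 sube0.
by rewrite lee_fin leNgt pi_gt0.
Qed.

End WeightedIntegral.

(** * Orthogonal polynomials of an abstract form on the circle *)

Section SemiclassicalForm.
Variables (R : realType).
Local Notation C := R[i].
Variable ip : {poly C} -> {poly C} -> C.
Hypothesis ipDl : forall f g h, ip (f + g) h = ip f h + ip g h.
Hypothesis ipZl : forall c f h, ip (c *: f) h = c * ip f h.
Hypothesis ip_herm : forall f g, ip g f = (ip f g)^*.
Hypothesis ipXX : forall f g, ip ('X * f) ('X * g) = ip f g.
Hypothesis ip_definite : forall f, ip f f = 0 -> f = 0.

Implicit Types (f g h : {poly C}) (c : C).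

Lemma ip0l f : ip 0 f = 0.
Proof. by rewrite -(scale0r 0) ipZl mul0r. Qed.

Lemma ipNl f g : ip (- f) g = - ip f g.
Proof. by rewrite -scaleN1r ipZl mulN1r. Qed.

Lemma ipBl f g h : ip (f - g) h = ip f h - ip g h.
Proof. by rewrite ipDl ipNl. Qed.

Lemma ipZr c f h : ip h (c *: f) = c^* * ip h f.
Proof. by rewrite 2!(ip_herm _ h) ipZl rmorphM. Qed.

Lemma ip_suml I (r : seq I) (P : pred I) (F : I -> {poly C}) g :
  ip (\sum_(i <- r | P i) F i) g = \sum_(i <- r | P i) ip (F i) g.
Proof.
apply: (big_morph (ip ^~ g)) => [x y|]; [exact: ipDl | exact: ip0l].
Qed.

Lemma ip_sumr I (r : seq I) (P : pred I) (F : I -> {poly C}) g :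
  ip g (\sum_(i <- r | P i) F i) = \sum_(i <- r | P i) ip g (F i).
Proof.
by rewrite ip_herm ip_suml rmorph_sum; apply: eq_bigr => i _; rewrite /= -ip_herm.
Qed.

Lemma poly_wide n f : (size f <= n)%N -> f = \sum_(i < n) f`_i *: 'X^i.
Proof.
move=> sf; rewrite -poly_def; apply/polyP => i; rewrite coef_poly.
by case: ltnP => // /(leq_trans sf) /(nth_default 0).
Qed.

Lemma ip_coefr n f g : (size g <= n)%N ->
  ip f g = \sum_(i < n) (g`_i)^* * ip f 'X^i.
Proof.
move=> /poly_wide {1}->; rewrite ip_sumr.
by apply: eq_bigr => i _; rewrite ipZr.
Qed.

Lemma ip_coefl n f g : (size f <= n)%N ->
  ip f g = \sum_(i < n) f`_i * ip 'X^i g.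
Proof.
move=> /poly_wide {1}->; rewrite ip_suml.
by apply: eq_bigr => i _; rewrite ipZl.
Qed.

(** The Toeplitz property: the moments depend only on i - j, here compared without subtraction. *)
Lemma ip_monomials i j k l : (i + l = k + j)%N ->
  ip 'X^i 'X^j = ip 'X^k 'X^l.
Proof.
have shift r p q : ip 'X^(r + p) 'X^(r + q) = ip 'X^p 'X^q.
  by elim: r => //= r IHr; rewrite !addSn !exprS ipXX.
by move=> e; rewrite -(shift l) -(shift j k) addnC e (addnC k) (addnC l).
Qed.

Lemma size_reversed n (f : {poly C}) : (size (reversed n f) <= n.+1)%N.
Proof. exact: size_poly. Qed.

Lemma coef_reversed n (f : {poly C}) i :
  (i <= n)%N -> (reversed n f)`_i = (f`_(n - i))^*.
Proof. by rewrite coef_poly ltnS => ->. Qed.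

Lemma reversedK n (f : {poly C}) : (size f <= n.+1)%N ->
  reversed n (reversed n f) = f.
Proof.
move=> sf; apply/polyP => i; rewrite coef_poly; case: ltnP => hi.
  by rewrite coef_reversed ?leq_subr// subKn ?conjCK.
by rewrite nth_default// (leq_trans sf).
Qed.

(** On the circle the reversal is f -> z^n conj(f), an antiunitary map; the algebraic form of this
    is the Toeplitz property after reindexing both sums. *)
Lemma ip_reversed n (f g : {poly C}) :
  (size f <= n.+1)%N -> (size g <= n.+1)%N ->
  ip (reversed n f) (reversed n g) = ip g f.
Proof.
move=> sf sg.
rewrite (ip_coefr _ (size_reversed n g)) (ip_coefl _ sg).
rewrite (reindex_inj rev_ord_inj) /=; apply: eq_bigr => i _.
have lei : (i <= n)%N by rewrite -ltnS.
rewrite coef_reversed ?subSS ?leq_subr// subKn// conjCK; congr (_ * _).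
rewrite (ip_coefl _ (size_reversed n f)) (ip_coefr _ sf).
rewrite (reindex_inj rev_ord_inj) /=; apply: eq_bigr => j _.
have lej : (j <= n)%N by rewrite -ltnS.
rewrite coef_reversed ?subSS ?leq_subr// subKn//; congr (_ * _).
by apply: ip_monomials; rewrite subnK// subnKC.
Qed.

Lemma ip_eq0 n f : (size f <= n.+1)%N -> f`_0 = 0 ->
  (forall j, (1 <= j <= n)%N -> ip f 'X^j = 0) -> f = 0.
Proof.
move=> sf f0 hf; apply: ip_definite; rewrite (ip_coefr _ sf) big1// => -[j hj] _.
case: j hj => [|j] hj /=; first by rewrite f0 conjC0 mul0r.
by rewrite hf ?mulr0.
Qed.

Variable Phi : nat -> {poly C}.
Hypothesis Phi_monic : forall n, Phi n \is monic.
Hypothesis Phi_size : forall n, size (Phi n) = n.+1.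
Hypothesis Phi_orth : forall m n, m != n -> ip (Phi m) (Phi n) = 0.
Let alpha := verblunsky Phi.
Local Notation Psi n := (reversed n (Phi n)).
Local Notation nrm n := (ip (Phi n) (Phi n)).

Lemma Phi_lead n : (Phi n)`_n = 1.
Proof. by have := monicP (Phi_monic n); rewrite lead_coefE Phi_size. Qed.

Lemma size_subPhi n (f : {poly C}) : (size f <= n.+1)%N ->
  (size (f - f`_n *: Phi n)%R <= n)%N.
Proof.
move=> sf; apply/leq_sizeP => j; rewrite leq_eqVlt => /predU1P[<-|hj].
  by rewrite coefB coefZ Phi_lead mulr1 subrr.
rewrite coefB coefZ [(Phi n)`_j]nth_default ?Phi_size// mulr0 subr0.
by rewrite nth_default// (leq_trans sf).
Qed.

Lemma ip_Phi_lower n f : (size f <= n)%N -> ip f (Phi n) = 0.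
Proof.
suff H k : (k <= n)%N -> forall f, (size f <= k)%N -> ip f (Phi n) = 0.
  exact: (H n).
elim: k => [|k IHk] hk {}f.
  by rewrite leqn0 size_poly_eq0 => /eqP ->; rewrite ip0l.
move=> sf; rewrite -(subrK (f`_k *: Phi k) f) ipDl ipZl Phi_orth ?ltn_eqF//.
by rewrite mulr0 addr0 IHk ?(ltnW hk)// size_subPhi.
Qed.

Lemma ip_Phi n f : (size f <= n.+1)%N -> ip f (Phi n) = f`_n * nrm n.
Proof.
move=> sf; rewrite -{1}(subrK (f`_n *: Phi n) f) ipDl ipZl.
by rewrite ip_Phi_lower ?add0r// size_subPhi.
Qed.

Lemma nrm_neq0 n : nrm n != 0.
Proof. by apply: contra_neq (monic_neq0 (Phi_monic n)); exact: ip_definite. Qed.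

Lemma nrm_conj n : (nrm n)^* = nrm n.
Proof. by rewrite -ip_herm. Qed.

(** The mirror image of [ip_Phi] under reversal; in particular Phi_n^* is orthogonal to z, ...,
    z^n. *)
Lemma ip_Psi n f : (size f <= n.+1)%N -> ip f (Psi n) = f`_0 * nrm n.
Proof.
move=> sf; rewrite -{1}(reversedK sf) ip_reversed ?size_reversed ?Phi_size//.
rewrite ip_herm ip_Phi ?size_reversed// rmorphM /= nrm_conj.
by rewrite coef_reversed// subnn conjCK.
Qed.

(** The convention alpha_{-1} = -1 makes this true for n = 0, which spares a separate treatment of
    degree 1, where alpha_{n-2} is alpha_{-1}. *)
Lemma Phi_at0 n : (Phi n)`_0 = - (alpha (n%:Z - 1))^*.
Proof.
case: n => [|n]; rewrite /alpha.
  by rewrite Phi_lead /= rmorphN rmorph1 opprK.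
have -> : n.+1%:Z - 1 = n%:Z by lia.
by rewrite /= rmorphN /= conjCK opprK horner_coef0.
Qed.

Lemma Psi_at0 n : (Psi n)`_0 = 1.
Proof. by rewrite coef_reversed// subn0 Phi_lead conjC1. Qed.

Lemma Psi_lead n : (Psi n)`_n = - alpha (n%:Z - 1).
Proof. by rewrite coef_reversed// subnn Phi_at0 rmorphN /= conjCK. Qed.

(** The terms of degree n + 1 cancel, the factor of [Psi n] is the one that cancels the constant
    terms, and all three polynomials are orthogonal to z, ..., z^n; so [ip_eq0] applies to the
    difference. *)
Lemma szego n : 'X * Phi n = Phi n.+1 + (alpha n%:Z)^* *: Psi n.
Proof.
apply/eqP; rewrite -subr_eq0; apply/eqP.
have a0 : (Phi n.+1)`_0 = - (alpha n%:Z)^*.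
  by rewrite Phi_at0; congr (- (alpha _)^*); lia.
have s1 : (size ('X * Phi n)%R <= n.+2)%N.
  by rewrite (leq_trans (size_polyMleq _ _))// size_polyX Phi_size.
have sz : (size ('X * Phi n - (Phi n.+1 + (alpha n%:Z)^* *: Psi n))%R <= n.+1)%N.
  apply/leq_sizeP => j; rewrite leq_eqVlt => /predU1P[<-|hj].
    rewrite coefB coefD coefZ coefXM /= !Phi_lead.
    by rewrite (nth_default _ (size_reversed _ _)) mulr0 addr0 subrr.
  rewrite coefB coefD coefZ !nth_default ?mulr0 ?addr0 ?subrr//.
  - by rewrite (leq_trans (size_reversed _ _))// ltnW.
  - by rewrite Phi_size.
  - exact: leq_trans s1 hj.
apply: (ip_eq0 sz) => [|j /andP[j1 jn]].
  by rewrite coefB coefD coefZ coefXM /= a0 Psi_at0 mulr1 addNr subrr.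
rewrite ipBl ipDl ipZl.
have -> : ip ('X * Phi n) 'X^j = 0.
  case: j j1 jn => // j _ jn; rewrite exprS ipXX ip_herm ip_Phi_lower ?conjC0//.
  by rewrite size_polyXn.
have -> : ip (Phi n.+1) 'X^j = 0.
  by rewrite ip_herm ip_Phi_lower ?conjC0// size_polyXn.
rewrite (ip_herm 'X^j) ip_Psi ?size_polyXn// coefXn.
by case: j j1 {jn} => // j _; rewrite mul0r conjC0 mulr0 addr0 subrr.
Qed.

(** The recurrence reversed at degree n + 1, where z Phi_n becomes Phi_n^* and Phi_n^* becomes z
    Phi_n. *)
Lemma szego_reversed n : Psi n.+1 = Psi n - alpha n%:Z *: ('X * Phi n).
Proof.
have e : Phi n.+1 = 'X * Phi n - (alpha n%:Z)^* *: Psi n.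
  by rewrite szego addrK.
apply/polyP => i; rewrite {1}e coefB coefZ coefXM coef_poly coefB coefZ coefXM.
case: ltnP => hi; last first.
  case: i hi => // i hi /=; rewrite [(Phi n)`_i]nth_default ?Phi_size//.
  by rewrite nth_default ?(leq_trans (size_reversed _ _)) ?mulr0 ?subrr// ltnW.
rewrite rmorphB rmorphM /= conjCK.
case: i hi => [_|i hi].
  rewrite subn0 /= mulr0 subr0 Psi_at0 Phi_lead conjC1.
  by rewrite (nth_default _ (size_reversed _ _)) conjC0 mulr0 subr0.
rewrite ltnS in hi; rewrite subSS /= (coef_reversed _ (leq_subr _ _)) subKn ?conjCK//.
rewrite subn_eq0; have [ni|ni] := leqP n i.
  rewrite conjC0 sub0r [(Psi n)`_i.+1]nth_default ?sub0r//.
  by rewrite (leq_trans (size_reversed _ _)).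
by rewrite coef_reversed// -subnS.
Qed.


Let conjE := (rmorphD, rmorphM, rmorphN, rmorph1, rmorphXn).

Variables (tau b : C).
Hypothesis tau_real : tau^* = tau.
Hypothesis pearson : forall f g,
  ip ('X * ('X - 1) * f^`() + (b + 1) *: ('X * f) + b^* *: f
      + tau *: ('X ^+ 2 * f - 'X * f - f)) g + tau * ip f ('X * g)
  = ip (('X - 1) * f) ('X * g^`()).

Lemma ip_shift_pearson f i :
  ip ('X * ('X - 1) * f^`()) 'X^(i.+1) =
  (i.+1)%:R * (ip f 'X^i - ip f 'X^(i.+1))
  - (b + 1) * ip f 'X^i - b^* * ip f 'X^(i.+1)
  - tau * (ip ('X * f) 'X^i - ip f 'X^i - ip f 'X^(i.+1) + ip f 'X^(i.+2)).
Proof.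
have := pearson f 'X^(i.+1).
have -> : 'X * ('X^(i.+1))^`() = i.+1%:R *: 'X^(i.+1) :> {poly C}.
  by rewrite derivXn mulrnAr -exprS scaler_nat.
rewrite mulrBl mul1r ipZr conjC_nat.
rewrite !(ipDl, ipZl, ipNl).
have -> : ip ('X * f) 'X^(i.+1) = ip f 'X^i by rewrite exprS ipXX.
have -> : ip ('X^2 * f) 'X^(i.+1) = ip ('X * f) 'X^i.
  by rewrite exprS ['X^(i.+1)]exprS -mulrA ipXX.
by rewrite -exprS => <-; ring.
Qed.

Lemma ipXS f i : ip ('X * f) 'X^(i.+1) = ip f 'X^i.
Proof. by rewrite exprS ipXX. Qed.

(** The factor i comes from z (z^i)' = i z^i. Both arguments of the Pearson identity for f' are
    multiplied by z, so that the test monomial and the first-order term z (z - 1) f' are those of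
    [ip_shift_pearson]. *)
Lemma ip_second_pearson f i :
  ip ('X^2 * ('X - 1) * f^`()^`() + (b + 1) *: ('X^2 * f^`())
      + b^* *: ('X * f^`())
      + tau *: ('X^3 * f^`() - 'X^2 * f^`() - 'X * f^`() + f^`())) 'X^(i.+1)
  = i%:R * ip ('X * ('X - 1) * f^`()) 'X^(i.+1).
Proof.
have := pearson f^`() 'X^i.
have -> : 'X * ('X^i)^`() = i%:R *: 'X^i :> {poly C}.
  by rewrite derivXn scaler_nat mulrnAr; case: i => // i; rewrite -exprS.
rewrite ipZr conjC_nat -exprS.
rewrite -ipXX -exprS -[X in _ = _ * X]ipXX -exprS mulrA => <-.
rewrite -ipZl -ipDl; congr ip.
by rewrite -!mul_polyC; ring.
Qed.

(** * Pearson relations at a fixed degree n >= 1 *)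

Section Degree.
Variable m : nat.
Let n := m.+1.
Let P := Phi n.
Let Q := Psi n.
Let h := nrm n.
Let l := P`_m.
Variables (a c d e : C).
Hypotheses (aE : alpha n%:Z = a) (cE : alpha m%:Z = c).
Hypotheses (dE : alpha (m%:Z - 1) = d) (eE : alpha n.+1%:Z = e).

Let h_neq0 : h != 0. Proof. exact: nrm_neq0. Qed.

(** z Phi_m is eliminated between the two recurrences. The gain is that z [Psi m] still has degree
    at most n, so products of z [Q] with [P] and [Q] reduce to coefficients and to those of z
    [P]. *)
Lemma Psi_step : Q = (1 - c * c^*) *: Psi m - c *: P.
Proof.
rewrite /Q /n szego_reversed cE szego -/P cE scalerDr scalerA scalerBl scale1r.
by rewrite opprD addrA addrAC.
Qed.

Lemma size_XM f k : (size f <= k)%N -> (size ('X * f)%R <= k.+1)%N.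
Proof. by move=> hf; rewrite (leq_trans (size_polyMleq _ _))// size_polyX. Qed.

Lemma coefX_deriv f k : ('X * f^`())`_k = k%:R * f`_k.
Proof.
by rewrite coefXM; case: k => [|k] /=; rewrite ?mul0r// coef_deriv mulr_natl.
Qed.

Lemma coef_derivE f k : f^`()`_k = k.+1%:R * f`_k.+1.
Proof. by rewrite coef_deriv mulr_natl. Qed.

Lemma coefXmulS f k : ('X * f)`_k.+1 = f`_k. Proof. by rewrite coefXM. Qed.

Lemma coefXmul0 f : ('X * f)`_0 = 0. Proof. by rewrite coefXM. Qed.

Let coefE' := (coefD, coefN, coefZ, coefXmulS).

Lemma size_deriv_leq f k : (size f <= k.+1)%N -> (size f^`() <= k)%N.
Proof.
move=> sf; apply/leq_sizeP => j hj.
by rewrite coef_deriv nth_default ?mul0rn// (leq_trans sf).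
Qed.

Let P_n : P`_n = 1. Proof. exact: Phi_lead. Qed.
Let P_0 : P`_0 = - c^*.
Proof. by rewrite Phi_at0 -cE; congr (- (alpha _)^*); rewrite /n; lia. Qed.
Let Q_n : Q`_n = - c.
Proof. by rewrite Psi_lead -cE; congr (- alpha _); rewrite /n; lia. Qed.
Let Q_0 : Q`_0 = 1. Proof. exact: Psi_at0. Qed.
Let sP : (size P <= n.+1)%N. Proof. by rewrite Phi_size. Qed.
Let sQ : (size Q <= n.+1)%N. Proof. exact: size_reversed. Qed.

Let ip_QP : ip Q P = - c * h. Proof. by rewrite ip_Phi// Q_n. Qed.
Let ip_PQ : ip P Q = - c^* * h. Proof. by rewrite ip_Psi// P_0. Qed.
Let ip_QQ : ip Q Q = h. Proof. by rewrite ip_Psi// Q_0 mul1r. Qed.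

Let ip_XPP : ip ('X * P) P = - a^* * c * h.
Proof.
rewrite /P szego ipDl ipZl Phi_orth ?gtn_eqF// add0r -/P -/Q ip_QP aE; ring.
Qed.

Let ip_XPQ : ip ('X * P) Q = a^* * h.
Proof.
rewrite /P szego ipDl ipZl -/Q ip_QQ aE -/n.
suff -> : ip (Phi n.+1) Q = 0 by rewrite add0r.
by rewrite ip_herm ip_Phi_lower ?conjC0.
Qed.

Let ip_XQP : ip ('X * Q) P = (- (1 - c * c^*) * d + c * c * a^*) * h.
Proof.
rewrite {1}Psi_step mulrBr -!scalerAr ipBl !ipZl ip_XPP.
rewrite ip_Phi ?size_XM ?size_reversed// coefXM /= Psi_lead dE -/h; ring.
Qed.

Let ip_XQQ : ip ('X * Q) Q = - c * a^* * h.
Proof.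
rewrite {1}Psi_step mulrBr -!scalerAr ipBl !ipZl ip_XPQ.
rewrite ip_Psi ?size_XM ?size_reversed// coefXM /= ; ring.
Qed.

(** Two uses of the recurrence; [Phi n.+2] is orthogonal to [P] and [Q]. This is how alpha_{n+1}
    enters the inner products. *)
Let XXP : 'X^2 * P =
  Phi n.+2 + e^* *: (Q - a *: ('X * P)) + a^* *: ('X * Q).
Proof.
have e1 : 'X * P = Phi n.+1 + a^* *: Q by rewrite -aE; exact: szego.
have e2 : 'X * Phi n.+1 = Phi n.+2 + e^* *: Psi n.+1 by rewrite -eE; exact: szego.
have e3 : Psi n.+1 = Q - a *: ('X * P) by rewrite -aE; exact: szego_reversed.
by rewrite exprS expr1 -mulrA {1}e1 mulrDr e2 e3 -scalerAr.
Qed.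

Let ip_XXPP : ip ('X^2 * P) P =
  (- e^* * c * (1 - a * a^*) - a^* * (1 - c * c^*) * d + (a^* * c) ^+ 2) * h.
Proof.
rewrite XXP !(ipDl, ipZl, ipNl) Phi_orth; last by rewrite gtn_eqF.
rewrite ip_QP ip_XPP ip_XQP; ring.
Qed.

Let ip_XXPQ : ip ('X^2 * P) Q = (e^* * (1 - a * a^*) - c * a^* ^+ 2) * h.
Proof.
rewrite XXP !(ipDl, ipZl, ipNl) ip_XPQ ip_XQQ ip_QQ.
suff -> : ip (Phi n.+2) Q = 0 by ring.
by rewrite ip_herm ip_Phi_lower ?conjC0// (leq_trans sQ).
Qed.

Variables s f0 g0 : C.
Hypothesis sE : s = - (b^* + n%:R) + tau * (1 + a * c^*).
Hypothesis f0E : f0 = (1 - s) * a + tau * (1 - a * a^*) * e.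
Hypothesis g0E : g0 = tau * (s + s^* * a^* * c + a^* * f0 + c * f0^*).

(** The operator z d/dz multiplies z^n by n, so [r] has degree below n. Thus z^2 P', of degree n +
    1, splits into n z P, whose products are known, and z r, to which [ip_Phi] and [ip_Psi]
    apply. *)
Let r := 'X * P^`() - n%:R *: P.

Let XdP : 'X * P^`() = n%:R *: P + r.
Proof. by rewrite /r addrC subrK. Qed.

Let size_r : (size r <= n)%N.
Proof.
apply/leq_sizeP => j; rewrite leq_eqVlt => /predU1P[<-|hj].
  by rewrite coefB coefZ coefX_deriv subrr.
by rewrite coefB coefZ coefX_deriv nth_default ?mulr0 ?subrr ?Phi_size.
Qed.

Let r_m : r`_m = - l.
Proof. rewrite coefB coefZ coefX_deriv -/l /n -(natr1 m); ring. Qed.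

Let XXdP : 'X * ('X - 1) * P^`() = n%:R *: ('X * P) + 'X * r - 'X * P^`().
Proof.
by rewrite /r -!mul_polyC; ring.
Qed.

Let sXdP : (size ('X * P^`())%R <= n.+1)%N.
Proof.
rewrite XdP (leq_trans (size_polyD _ _))// geq_max.
by rewrite (leq_trans (size_scale_leq _ _))//= ltnW.
Qed.

Let sXr : (size ('X * r)%R <= n.+1)%N.
Proof. exact: size_XM. Qed.

Let ip_P_lower g : (size g <= n)%N -> ip P g = 0.
Proof. by move=> sg; rewrite ip_herm ip_Phi_lower ?conjC0. Qed.

Let h_conj : h^* = h. Proof. exact: nrm_conj. Qed.

(* The Pearson identity between Phi_n and Phi_n^*. *)
Lemma discrete_painleve : f0 = - s^* * c + tau * (1 - c * c^*) * d.
Proof.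
have sXdQ : (size ('X * Q^`())%R <= n.+1)%N.
  by apply/size_XM/size_deriv_leq.
have dQ : ip P Q^`() = 0 by apply/ip_P_lower/size_deriv_leq.
have := pearson P Q.
rewrite XXdP mulrBl mul1r !(ipDl, ipZl, ipNl) ipXX.
rewrite (ip_herm ('X * Q)) ip_XQP ip_XXPQ ip_XPQ ip_PQ dQ.
rewrite (ip_Psi sXr) (ip_Psi sXdP) coefXM /= coefX_deriv mul0r.
rewrite (ip_herm ('X * Q^`())) (ip_Phi sXdQ).
rewrite coefX_deriv Q_n !(rmorphN, rmorphM) /= conjC_nat ?conjCK.
rewrite -/h h_conj => /eqP; rewrite -subr_eq0 => /eqP z.
(* The Pearson identity is the conjugate of the claim, multiplied by [h]. *)
apply: (can_inj conjCK); apply: (mulIf h_neq0); apply/eqP.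
rewrite -subr_eq0 -[X in _ == X]z f0E sE.
rewrite !conjE /= !(conjCK, conjC_nat) tau_real; apply/eqP; ring.
Qed.

(* The Pearson identity between Phi_n and itself. *)
Lemma gammaE : g0 = - tau * (n%:R + l).
Proof.
have dP : ip P P^`() = 0 by apply/ip_P_lower/size_deriv_leq.
have := pearson P P.
rewrite XXdP mulrBl mul1r !(ipDl, ipZl, ipNl) ipXX.
rewrite (ip_herm ('X * P) P) ip_XXPP ip_XPP dP (ip_Phi sXr) (ip_Phi sXdP).
rewrite (ip_herm ('X * P^`())) (ip_Phi sXdP) coefXM /= r_m coefX_deriv P_n.
rewrite !conjE /= !conjCK conjC_nat -/h h_conj => /eqP; rewrite -subr_eq0 => /eqP z.
rewrite g0E mulNr -mulrN; congr (tau * _).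
(* Only the unconjugated [f0] takes its second form: its part in [s^*] cancels [s^* * a^* * c], its
   part in [d] matches the one of [ip_XXPP], and [f0^*] in its first form supplies the part in
   [e^*]. *)
rewrite {1}discrete_painleve; apply/esym/(mulIf h_neq0); apply/eqP.
rewrite -subr_eq0 -[X in _ == X]z f0E sE.
rewrite !conjE /= !(conjCK, conjC_nat) tau_real; apply/eqP; ring.
Qed.


(** * Coefficients and moments that enter the differential equations *)

Let Q_m : Q`_m = - (1 - c * c^*) * d - c * l.
Proof. rewrite Psi_step coefB !coefZ Psi_lead dE -/l; ring. Qed.

Let P_1 : P`_1 = - (1 - c * c^*) * d^* - c^* * l^*.
Proof.
have := Q_m; rewrite coef_reversed ?leqnSn// subSnn => /(canRL conjCK) ->.
by rewrite !conjE /= conjCK; ring.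
Qed.

Let Q_1 : Q`_1 = l^*.
Proof. by rewrite coef_reversed// subSS subn0. Qed.

Let Pz j : P`_(j + n).+1 = 0.
Proof. by rewrite nth_default// (leq_trans sP)// ltnS leq_addl. Qed.

Let Qz j : Q`_(j + n).+1 = 0.
Proof. by rewrite nth_default// (leq_trans sQ)// ltnS leq_addl. Qed.

Let ip_PX i : (i < n)%N -> ip P 'X^i = 0.
Proof. by move=> hi; rewrite ip_P_lower// size_polyXn. Qed.

Let ip_PXn : ip P 'X^n = h.
Proof. by rewrite ip_herm ip_Phi ?size_polyXn// coefXn eqxx mul1r h_conj. Qed.

Let ip_QX i : (0 < i <= n)%N -> ip Q 'X^i = 0.
Proof.
case: i => // i hi; rewrite ip_herm ip_Psi ?size_polyXn// coefXn.
by rewrite mul0r conjC0.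
Qed.

Let ip_Q1 : ip Q 'X^0 = h.
Proof. by rewrite ip_herm ip_Psi ?size_polyXn// coefXn mul1r h_conj. Qed.

Let ip_XP1 : ip ('X * P) 'X^0 = a^* * h.
Proof.
rewrite szego ipDl ipZl aE -/Q ip_Q1.
have -> : ip (Phi n.+1) 'X^0 = 0; last by rewrite add0r.
by rewrite ip_herm ip_Phi_lower ?conjC0// size_polyXn.
Qed.

Let ip_XnP : ip ('X^(n.+1)) P = (- a^* * c - l) * h.
Proof.
have -> : 'X^(n.+1) = 'X * P - 'X * (P - 'X^n) :> {poly C}.
  by rewrite exprS; ring.
have sz : (size (P - 'X^n)%R <= n)%N.
  have := size_subPhi (n := n) (f := 'X^n); rewrite size_polyXn coefXn eqxx scale1r.
  by rewrite -opprB size_polyN; apply.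
rewrite ipBl ip_XPP ip_Phi ?size_XM// coefXM /= coefB coefXn.
by rewrite ltn_eqF//= subr0 -/l -/h; ring.
Qed.

Let ip_PXSn : ip P 'X^(n.+1) = (- a * c^* - l^*) * h.
Proof. by rewrite ip_herm ip_XnP !conjE /= conjCK h_conj; ring. Qed.

(** On the circle z Phi_n^* = z^(n+1) conj(Phi_n), so this is the product of z^(n+1) and Phi_n,
    already computed in [ip_XnP]. *)
Let ip_XQ1 : ip ('X * Q) 'X^0 = (- a^* * c - l) * h.
Proof.
rewrite (ip_coefl _ (size_XM sQ)) -ip_XnP (ip_coefr _ sP).
rewrite big_ord_recl coefXM mul0r add0r.
rewrite (reindex_inj rev_ord_inj) /=; apply: eq_bigr => j _.
have lej : (j <= n)%N by rewrite -ltnS.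
rewrite coefXM /= subSS coef_reversed ?leq_subr// subKn//; congr (_ * _).
by apply: ip_monomials; rewrite /bump /= add1n addSn subnK// addn0.
Qed.

(** [dl] is the Kronecker delta of i and 0. It keeps the test against z in one computation with the
    others, since only [dl * i = 0] is needed. *)
Let ip_delta0 i : (i < n)%N -> exists dl : C,
  [/\ ip ('X * P) 'X^i = dl * (a^* * h), ip Q 'X^i = dl * h & dl * i%:R = 0].
Proof.
case: i => [_|i hi]; first by exists 1; split; rewrite ?mul1r// mulr0.
exists 0; rewrite !mul0r (@ip_QX i.+1 (ltnW hi)) ipXS (ip_PX (ltnW hi)).
by split.
Qed.

(* Left-hand side minus right-hand side of the first equation, with tau = t / 2;
   the first four terms are those of [ip_second_pearson]. *)
Definition first_defect :=
  'X^2 * ('X - 1) * P^`()^`() + (b + 1) *: ('X^2 * P^`())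
  + b^* *: ('X * P^`())
  + tau *: ('X^3 * P^`() - 'X^2 * P^`() - 'X * P^`() + P^`())
  + (2 - n%:R) *: ('X * ('X - 1) * P^`())
  - (tau * n%:R) *: ('X * ('X * P))
  - (n%:R * (b + 2) + g0 - 2 * tau * a^* * c) *: ('X * P)
  - (- tau * n%:R + s - g0^*) *: P
  + (2 * tau * a^*) *: ('X * Q) + f0^* *: Q.

Lemma first_ode : first_defect = 0.
Proof.
have g1 := gammaE; have f1 := discrete_painleve.
have E : first_defect =
    'X * ('X * ('X * P^`()^`())) - 'X * ('X * P^`()^`())
    + (b + 1 - tau + 2 - n%:R) *: ('X * ('X * P^`()))
    + (b^* - tau - 2 + n%:R) *: ('X * P^`())
    + tau *: ('X * ('X * ('X * P^`())) + P^`())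
  - (tau * n%:R) *: ('X * ('X * P))
  - (n%:R * (b + 2) + g0 - 2 * tau * a^* * c) *: ('X * P)
  - (- tau * n%:R + s - g0^*) *: P
  + (2 * tau * a^*) *: ('X * Q) + f0^* *: Q.
  by rewrite /first_defect -!mul_polyC; ring.
have Ek k : first_defect`_k.+2 = k%:R * k.+1%:R * P`_k.+1
    - k.+1%:R * k.+2%:R * P`_k.+2
    + (b + 1 - tau + 2 - n%:R) * (k.+1%:R * P`_k.+1)
    + (b^* - tau - 2 + n%:R) * (k.+2%:R * P`_k.+2)
    + tau * (k%:R * P`_k + k.+3%:R * P`_k.+3)
  - (tau * n%:R) * P`_k
  - (n%:R * (b + 2) + g0 - 2 * tau * a^* * c) * P`_k.+1
  - (- tau * n%:R + s - g0^*) * P`_k.+2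
  + (2 * tau * a^*) * Q`_k.+1 + f0^* * Q`_k.+2.
  by rewrite E !coefE' !coefX_deriv !coef_derivE; ring.
apply: (@ip_eq0 n).
- apply/leq_sizeP => -[//|[|k]]; first by rewrite ltnS ltn0.
  rewrite /n !ltnS => hk; rewrite Ek.
  (* Above degree n only two coefficients need cancellation: that of z^(n+1), through the value of
     gamma_n, and that of z^(n+2), where the leading terms cancel. *)
  move: hk; rewrite leq_eqVlt => /predU1P[<-|].
    rewrite -/l [P`_m.+1]P_n [Q`_m.+1]Q_n [P`_m.+2](Pz 0%N) [P`_m.+3](Pz 1%N).
    by rewrite [Q`_m.+2](Qz 0%N) g1 /n; ring.
  rewrite leq_eqVlt => /predU1P[<-|hk].
    rewrite [P`_m.+1]P_n [P`_m.+2](Pz 0%N) [P`_m.+3](Pz 1%N) [P`_m.+4](Pz 2%N).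
    by rewrite [Q`_m.+2](Qz 0%N) [Q`_m.+3](Qz 1%N) /n; ring.
  rewrite -(subnK hk) addnS; move: (k - m.+2)%N => j; rewrite -/n.
  rewrite [P`_(j + n).+1]Pz [P`_(j + n).+2](Pz j.+1) [P`_(j + n).+3](Pz j.+2).
  rewrite [P`_(j + n).+4](Pz j.+3) [Q`_(j + n).+2](Qz j.+1).
  by rewrite [Q`_(j + n).+3](Qz j.+2); ring.
(* [P_1] contains [d^*], hence the second form of [f0]. *)
- rewrite E !coefE' !coefXmul0 coef_derivE P_1 P_0 Q_0 f1 g1 sE.
  rewrite !conjE /= !(conjCK, conjC_nat) tau_real; ring.
case=> // i /= hi; rewrite /first_defect.
rewrite 6!ipDl ip_second_pearson !(ipNl, ipZl) ip_shift_pearson !ipXS.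
rewrite (ip_PX hi) (@ip_QX i.+1 hi).
have [dl [U V dl0]] := ip_delta0 hi; rewrite U V.
have [im|im] := eqVneq i m.
  rewrite im ip_PXn ip_PXSn g1 sE !conjE /= conjC_nat tau_real.
  transitivity (- tau * a^* * h * (dl * i%:R)); last by rewrite dl0 mulr0.
  by rewrite im /n; ring.
have hi' : (i.+1 < n)%N by rewrite ltnS ltn_neqAle im.
rewrite (ip_PX hi').
(* Here i + 2 <= n, so the product can be nonzero only for i + 2 = n, where the factor vanishes.
   This is the role of [2 - n] in [first_defect], which adds to the factor i of
   [ip_second_pearson]. *)
have Z : (i%:R + 2 - n%:R) * ip P 'X^(i.+2) = 0.
  have [->|ni] := eqVneq n i.+2; first by rewrite -(natrD _ i 2) addn2 subrr mul0r.
  by rewrite ip_PX ?mulr0// ltn_neqAle eq_sym ni.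
transitivity (- tau * a^* * h * (dl * i%:R)
              - tau * ((i%:R + 2 - n%:R) * ip P 'X^(i.+2))).
  ring.
by rewrite dl0 Z !mulr0 subr0.
Qed.

(** Again the left-hand side minus the right-hand side, grouped so that, beyond the terms of
    [ip_second_pearson], the derivative of [Q] occurs only in a multiple of z (z - 1) Q', to which
    [ip_shift_pearson] applies; the multiple is now governed by [1 - n]. *)
Definition second_defect :=
  - ('X^2 * ('X - 1) * Q^`()^`() + (b + 1) *: ('X^2 * Q^`())
     + b^* *: ('X * Q^`())
     + tau *: ('X^3 * Q^`() - 'X^2 * Q^`() - 'X * Q^`() + Q^`()))
  - (1 - n%:R) *: ('X * ('X - 1) * Q^`())
  + (tau * (n%:R - 2)) *: ('X * ('X * Q))
  + (n%:R * (b + 1) + g0 + s^*) *: ('X * Q)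
  + (- g0^* - tau * n%:R) *: Q
  - (2 * tau * c) *: ('X * ('X * P)) - f0 *: ('X * P).

Lemma second_ode : second_defect = 0.
Proof.
have g1 := gammaE; have f1 := discrete_painleve.
have E : second_defect =
    - ('X * ('X * ('X * Q^`()^`())) - 'X * ('X * Q^`()^`())
    + (b - tau + 2 - n%:R) *: ('X * ('X * Q^`()))
    + (b^* - tau - 1 + n%:R) *: ('X * Q^`())
    + tau *: ('X * ('X * ('X * Q^`())) + Q^`()))
  + (tau * (n%:R - 2)) *: ('X * ('X * Q))
  + (n%:R * (b + 1) + g0 + s^*) *: ('X * Q)
  + (- g0^* - tau * n%:R) *: Q
  - (2 * tau * c) *: ('X * ('X * P)) - f0 *: ('X * P).
  by rewrite /second_defect -!mul_polyC; ring.
have Ek k : second_defect`_k.+2 = - (k%:R * k.+1%:R * Q`_k.+1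
    - k.+1%:R * k.+2%:R * Q`_k.+2
    + (b - tau + 2 - n%:R) * (k.+1%:R * Q`_k.+1)
    + (b^* - tau - 1 + n%:R) * (k.+2%:R * Q`_k.+2)
    + tau * (k%:R * Q`_k + k.+3%:R * Q`_k.+3))
  + (tau * (n%:R - 2)) * Q`_k
  + (n%:R * (b + 1) + g0 + s^*) * Q`_k.+1
  + (- g0^* - tau * n%:R) * Q`_k.+2
  - (2 * tau * c) * P`_k - f0 * P`_k.+1.
  by rewrite E !coefE' !coefX_deriv !coef_derivE; ring.
apply: (@ip_eq0 n).
- apply/leq_sizeP => -[//|[|k]]; first by rewrite ltnS ltn0.
  rewrite /n !ltnS => hk; rewrite Ek.
  move: hk; rewrite leq_eqVlt => /predU1P[<-|].
    rewrite -/l [P`_m.+1]P_n [Q`_m.+1]Q_n [Q`_m.+2](Qz 0%N) [Q`_m.+3](Qz 1%N).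
    by rewrite Q_m f1 g1 /n; ring.
  rewrite leq_eqVlt => /predU1P[<-|hk].
    rewrite [P`_m.+1]P_n [Q`_m.+1]Q_n [Q`_m.+2](Qz 0%N) [Q`_m.+3](Qz 1%N).
    by rewrite [Q`_m.+4](Qz 2%N) [P`_m.+2](Pz 0%N) /n; ring.
  rewrite -(subnK hk) addnS; move: (k - m.+2)%N => j; rewrite -/n.
  rewrite [Q`_(j + n).+1]Qz [Q`_(j + n).+2](Qz j.+1) [Q`_(j + n).+3](Qz j.+2).
  rewrite [Q`_(j + n).+4](Qz j.+3) [P`_(j + n).+1]Pz.
  by rewrite [P`_(j + n).+2](Pz j.+1); ring.
- rewrite E !coefE' !coefXmul0 coef_derivE Q_1 Q_0 g1.
  by rewrite !conjE /= !conjC_nat tau_real; ring.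
case=> // i /= hi; rewrite /second_defect.
rewrite 6!ipDl ipNl ip_second_pearson !(ipNl, ipZl) ip_shift_pearson !ipXS.
rewrite (ip_PX hi) (@ip_QX i.+1 hi).
(* [Q] is orthogonal to z, ..., z^n, one power further than [P], so the only exception is i + 1 = n;
   hence [1 - n] in place of [2 - n]. *)
have W : (i%:R + 1 - n%:R) * ip Q 'X^(i.+2) = 0.
  have [->|ni] := eqVneq n i.+1; first by rewrite -(natrD _ i 1) addn1 subrr mul0r.
  by rewrite (@ip_QX i.+2) ?mulr0//= ltn_neqAle eq_sym ni.
(* The nonzero product of [Q] with 1 occurs for i = 0, where gamma_n and s_{n,n} enter, and for i =
   1, where the coefficient [n - 2] of z^2 Q cancels it; for larger i only the term of [W] is
   left. *)
case: i hi W => [|[|i]] hi W.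
- rewrite ip_Q1 ip_XQ1 ip_XP1.
  transitivity (tau * ((0%:R + 1 - n%:R) * ip Q 'X^2)); last by rewrite W mulr0.
  rewrite g1 sE !conjE /= !(conjCK, conjC_nat) tau_real; ring.
- rewrite !ipXS ip_Q1 ip_PX // (@ip_QX 1) ?(ltnW hi)//.
  transitivity (tau * ((1%:R + 1 - n%:R) * ip Q 'X^3)); last by rewrite W mulr0.
  ring.
rewrite !ipXS (@ip_QX i.+1) ?ip_PX ?(@ip_QX i.+2)//; try lia.
transitivity (tau * ((i.+2%:R + 1 - n%:R) * ip Q 'X^(i.+4))); last by rewrite W mulr0.
ring.
Qed.

End Degree.
End SemiclassicalForm.

Theorem theorem4p10 (R : realType) (t eta lam : R) (Phi : nat -> {poly R[i]})
    (n : nat) (hlam : - (1 / 2) < lam)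
    (hPhi : monic_orthogonal (weight t eta lam) Phi) (hn : (1 <= n)%N) :
  let b := (lam +i* eta)%C in
  let T := t%:C%C in
  let alpha := verblunsky Phi in
  let an := alpha n%:Z in
  let am := alpha (n%:Z - 1) in
  let s := s_coef t b alpha n in
  let f := f_coef t b alpha n in
  let g := gamma_coef t b alpha n in
  let P := Phi n in
  let Q := reversed n (Phi n) in
  (forall z : R[i],
    z ^+ 2 * (z - 1) * P^`()^`().[z]
    + (T / 2 * z ^+ 3 + (b + 3 - n%:R - T / 2) * z ^+ 2
       + (b^* + n%:R - 2 - T / 2) * z + T / 2) * P^`().[z]
    - (T / 2 * n%:R * z ^+ 2
       + (n%:R * (b + 2) + g - T * an^* * am) * z
       - T / 2 * n%:R + s - g^*) * P.[z]
    = - (T * an^* * z + f^*) * Q.[z])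
  /\
  (forall z : R[i],
    z ^+ 2 * (1 - z) * Q^`()^`().[z]
    - (T / 2 * z ^+ 3 + (b + 2 - n%:R - T / 2) * z ^+ 2
       + (b^* + n%:R - 1 - T / 2) * z + T / 2) * Q^`().[z]
    + (T / 2 * (n%:R - 2) * z ^+ 2
       + (n%:R * (b + 1) + g + s^*) * z
       - g^* - T / 2 * n%:R) * Q.[z]
    = z * (T * am * z + f) * P.[z]).
Proof.
case: n hn => // m _ b T alpha an am s f g P Q.
have [Phi_monic Phi_size Phi_orth] := hPhi.
pose tau := (t / 2)%:C%C : R[i].
have TE : T = 2 * tau by rewrite /T /tau -(rmorph_nat (real_complex R) 2) -rmorphM /= mulrC divfK.
have T2 : T / 2 = tau by rewrite TE mulrC mulKf.
have amE : am = alpha m%:Z by congr alpha; lia.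
have tau_real : tau^* = tau by rewrite conj_complexE /= oppr0.
have sE : s = - (b^* + m.+1%:R) + tau * (1 + an * am^*).
  by rewrite /s /s_coef -/T T2.
have fE : f = (1 - s) * an + tau * (1 - an * an^*) * alpha m.+2%:Z.
  rewrite /f /f_coef -/T T2 normCK -/s -/an; congr (_ + _ * alpha _); lia.
have gE : g = tau * (s + s^* * an^* * am + an^* * f + am * f^*).
  by rewrite /g /gamma_coef -/T T2.
rewrite amE in sE fE gE *.
have F1 := first_ode (@circle_innerDl R t eta lam hlam) (@circle_innerZl R t eta lam hlam)
  (@circle_inner_herm R t eta lam hlam) (@circle_innerXX R t eta lam)
  (@circle_inner_definite R t eta lam hlam) Phi_monic Phi_size Phi_orth
  tau_real (@circle_inner_pearson R t eta lam hlam) erefl erefl erefl erefl sE fE gE.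
have F2 := second_ode (@circle_innerDl R t eta lam hlam) (@circle_innerZl R t eta lam hlam)
  (@circle_inner_herm R t eta lam hlam) (@circle_innerXX R t eta lam)
  (@circle_inner_definite R t eta lam hlam) Phi_monic Phi_size Phi_orth
  tau_real (@circle_inner_pearson R t eta lam hlam) erefl erefl erefl erefl sE fE gE.
split=> z; apply/eqP; rewrite -subr_eq0 T2 TE; apply/eqP.
  have := congr1 (horner^~ z) F1; rewrite /first_defect horner0 => <-.
  rewrite !(hornerD, hornerM, hornerZ, hornerN, hornerX, hornerC, hornerXn).
  rewrite -/P -/Q -/alpha -/an -/b; ring.
have := congr1 (horner^~ z) F2; rewrite /second_defect horner0 => <-.
rewrite !(hornerD, hornerM, hornerZ, hornerN, hornerX, hornerC, hornerXn).
rewrite -/P -/Q -/alpha -/an -/b; ring.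
Qed.
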